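(* Let $\mathfrak m:A\to\mathbb R^d$ be a minimal form on a finite connected graph $G=(V,E)$ with set of oriented edges $A$, satisfying $\Phi_{\mathfrak m}(\mathcal C)=\mathbb Z^d$, where $\mathcal C$ is the cycle space of $G$ and $\Phi_{\mathfrak m}$ is the flux function of $\mathfrak m$. Then the operator $\mathscr A(\vartheta):\ell^2(V)\to\ell^2(V)$, $\vartheta\in\mathbb T^d$, defined by $$(\mathscr A(\vartheta)f)(v)=\varkappa_vf(v)-\sum_{\mathbf e=(v,u)\in A}e^{i\langle\mathfrak m(\mathbf e),\vartheta\rangle}f(u),\qquad v\in V,$$ is a fiber operator for the Laplacian $\Delta$ on some periodic graph $\mathcal G$ with fundamental graph $G_*=G$.
   Context: Graphs. Graphs may have loops and multiple edges. Each unoriented edge (including a loop) has two orientations, giving two oriented edges. $(u,v)$ denotes an oriented edge from $u$ to $v$, and $\underline{\mathbf e}$ the inverse of $\mathbf e$. The degree $\varkappa_v$ is the number of oriented edges starting at $v$. A cycle is a closed path of oriented edges; the cycle space $\mathcal C$ of a finite connected graph is generated by its cycles (first homology group with integer coefficients). Forms. A 1-form on a finite connected graph with oriented edge set $A$ is a map $\mathfrak b:A\to\mathbb R^d$ with $\mathfrak b(\underline{\mathbf e})=-\mathfrak b(\mathbf e)$; its flux function is $\Phi_{\mathfrak b}(\mathbf c)=\sum_{\mathbf e\in\mathbf c}\mathfrak b(\mathbf e)$, $\mathbf c\in\mathcal C$. For a 1-form $\mathbf x$, $\mathscr F(\mathbf x)$ is the set of all 1-forms $\mathfrak b$ with $\Phi_{\mathfrak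 b}=\Phi_{\mathbf x}$. A 1-form $\mathfrak m$ is minimal if it has the smallest support cardinality $\#\operatorname{supp}$ (support as a subset of $A$) among all forms of $\mathscr F(\mathfrak m)$. Periodic graphs. $\Gamma\subset\mathbb R^d$ is a lattice of rank $d$ with basis $\mathbb A=\{a_1,\ldots,a_d\}$ and fundamental cell $\Omega=\{\sum_st_sa_s:0\le t_s<1\}$. A $\Gamma$-periodic graph $\mathcal G=(\mathcal V,\mathcal E)$ is a connected infinite locally finite graph embedded in $\mathbb R^d$ (vertices are distinct points) with $\mathcal G+a=\mathcal G$ for all $a\in\Gamma$ and with finite quotient $G_*=\mathcal G/\Gamma=(\mathcal V_*,\mathcal E_* )$, called the fundamental graph; $\mathcal A$ and $\mathcal A_*=\mathcal A/\Gamma$ are the sets of oriented edges of $\mathcal G$ and $G_*$. Vertices of $G_*$ are identified with the vertices of $\mathcal G$ in $\Omega$. For $x=\sum_st_sa_s$ put $x_{\mathbb A}=(t_1,\ldots,t_d)$. The coordinate form is $\kappa(\mathbf e_* )=v_{\mathbb A}-u_{\mathbb A}$ and the index form is $\tau(\mathbf e_* )=[v]_{\mathbb A}-[u]_{\mathbb A}$ for any $\mathbf e=(u,v)\in\mathcal A$ in the class $\mathbf e_*\in\mathcal A_*$, where each $v\in\mathcal V$ is uniquely written $v=\{v\}+[v]$ with $\{v\}\in\Omega$, $[v]\in\Gamma$. Fiber operators. The Laplacian is $(\Delta f)(v)=\sum_{(v,u)\in\mathcal A}(f(v)-f(u))$ on $\ell^2(\mathcal V)$. $\mathbb T^d=\mathbb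 R^d/(2\pi\mathbb Z)^d$, $\langle\cdot,\cdot\rangle$ is the standard inner product in $\mathbb R^d$, $\mathscr H=\int^\oplus_{\mathbb T^d}\ell^2(\mathcal V_* )\frac{d\vartheta}{(2\pi)^d}$. A family $\mathscr A(\vartheta)$ on $\ell^2(\mathcal V_* )$ is a fiber operator for $\Delta$ if $\mathscr U\Delta\mathscr U^{-1}=\int^\oplus_{\mathbb T^d}\mathscr A(\vartheta)\frac{d\vartheta}{(2\pi)^d}$ with the unitary $\mathscr U=W_{\mathfrak b}U:\ell^2(\mathcal V)\to\mathscr H$ for some $\mathfrak b\in\mathscr F(\kappa)$, where $U$ is the Gelfand transformation $(Uf)(\vartheta,v)=\sum_{\mathrm n\in\mathbb Z^d}e^{-i\langle\mathrm n,\vartheta\rangle}f(v+n_1a_1+\ldots+n_da_d)$ and $W_{\mathfrak b}$ is the gauge transformation $(W_{\mathfrak b}g)(\vartheta,v)=e^{i\langle w_{\mathfrak b}(v),\vartheta\rangle}g(\vartheta,v)$, with $w_{\mathfrak b}(v)=\sum_s(\tau(\mathbf e_s)-\mathfrak b(\mathbf e_s))$ along any path $(\mathbf e_1,\ldots,\mathbf e_n)$ on $G_*$ from a fixed vertex $v_0\in\mathcal V_*$ to $v$ (independent of the path; $\mathfrak b=\tau$ gives $W_\tau=\mathrm{Id}$). *)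

(* Defs.v *)
From HB Require Import structures.
From mathcomp Require Import all_boot all_order all_algebra finmap.
From mathcomp Require Import all_classical all_reals all_analysis.
From mathcomp.real_closed Require Import complex.

Set Implicit Arguments.
Unset Strict Implicit.
Unset Printing Implicit Defensive.

Import Order.TTheory GRing.Theory Num.Theory.

Local Open Scope classical_set_scope.
Local Open Scope ring_scope.

(* Graphs with loops and multiple edges, given by their oriented edges: an
   unoriented edge is a pair {e, inv e}. Since inv has no fixed point, a loop
   also consists of two oriented edges and contributes 2 to the degree. *)
Record mgraph (V E : Type) := MGraph {
  src : E -> V;
  tgt : E -> V;
  inv : E -> E;
  invK : involutive inv;
  inv_neq : forall e, inv e <> e;
  src_inv : forall e, src (inv e) = tgt e
}.

Section Graph.
Context {V E : Type}.
Variable G : mgraph V E.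

Fixpoint walk (u : V) (p : seq E) (v : V) : Prop :=
  if p is e :: p' then src G e = u /\ walk (tgt G e) p' v else u = v.

Definition connected_graph := forall u v, exists p, walk u p v.

End Graph.

Section Forms.
Context {R : realType} {d : nat} {V A : finType}.
Variable G : mgraph V A.
Implicit Types (b x : A -> 'rV[R]_d) (c : {ffun A -> int}).

(* Integer 1-chains are the functions c : A -> Z with c (inv e) = - c e; the
   chain of a path counts each oriented edge with sign. *)
Definition path_chain (p : seq A) : {ffun A -> int} :=
  [ffun e => (count_mem e p)%:Z - (count_mem (inv G e) p)%:Z].

(* The subgroup of 1-chains generated by the closed paths. *)
Inductive cycle_space : {ffun A -> int} -> Prop :=
| cycle_space_cycle u p : walk G u p u -> cycle_space (path_chain p)
| cycle_space_sub c1 c2 :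
    cycle_space c1 -> cycle_space c2 -> cycle_space (c1 - c2).

Definition one_form b := forall e, b (inv G e) = - b e.

(* The sum runs over oriented edges, so every unoriented edge occurs twice;
   see flux_path. *)
Definition flux b c : 'rV[R]_d := 2^-1 *: \sum_(e : A) (c e)%:~R *: b e.

Lemma flux_path b p : one_form b -> flux b (path_chain p) = \sum_(e <- p) b e.
Proof.
move=> bform; rewrite /flux.
have cnt (q : seq A) (f : A -> 'rV[R]_d) :
    \sum_(e : A) (count_mem e q)%:R *: f e = \sum_(e <- q) f e.
  elim: q => [|a q IH]; first by rewrite big_nil big1 // => e _; rewrite scale0r.
  rewrite big_cons -IH.
  transitivity (\sum_(e : A) ((a == e)%:R *: f e + (count_mem e q)%:R *: f e)).
    by apply: eq_bigr => e _ /=; rewrite natrD scalerDl.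
  rewrite big_split /= (bigD1 a) //= eqxx scale1r big1 ?addr0 // => e.
  by rewrite eq_sym => /negbTE->; rewrite scale0r.
have -> : \sum_e (path_chain p e)%:~R *: b e =
    \sum_e (count_mem e p)%:R *: b e -
    \sum_e (count_mem (inv G e) p)%:R *: b e.
  rewrite -sumrB; apply: eq_bigr => e _.
  by rewrite ffunE rmorphB /= scalerBl.
have -> : \sum_e (count_mem (inv G e) p)%:R *: b e = - \sum_(e <- p) b e.
  rewrite (reindex_inj (can_inj (invK G))) /= -sumrN.
  rewrite -(cnt p (fun e => - b e)).
  by apply: eq_bigr => e _; rewrite invK bform.
rewrite cnt opprK -[X in X + X]scale1r -scalerDl scalerA.
by rewrite mulVf ?scale1r // pnatr_eq0.
Qed.

(* The set F(x). *)
Definition same_flux x : set (A -> 'rV[R]_d) :=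
  [set b | one_form b /\ forall c, cycle_space c -> flux b c = flux x c].

Definition form_supp b : {set A} := [set e | b e != 0]%SET.

Definition minimal_form b :=
  one_form b /\ forall b', same_flux b b' -> (#|form_supp b| <= #|form_supp b'|)%N.

End Forms.

(* The vectors of Z^d inside R^d. *)
Definition zvec {R : realType} {d : nat} (n : 'rV[int]_d) : 'rV[R]_d :=
  map_mx intr n.

(* A lattice basis a_1, ..., a_d is given by the rows of an invertible matrix
   [basis], so that n_1 a_1 + ... + n_d a_d is [zvec n *m basis]. Only vertices
   are placed in R^d; as multiple edges are allowed, the translations of the
   edges are part of the data. *)
Record periodic_graph (R : realType) (d : nat) := PeriodicGraph {
  pvertex : choiceType;
  pedge : choiceType;
  pgraph :> mgraph pvertex pedge;
  basis : 'M[R]_d;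
  basis_unit : basis \in unitmx;
  pos : pvertex -> 'rV[R]_d;
  pos_inj : injective pos;
  trV : 'rV[int]_d -> pvertex -> pvertex;
  trE : 'rV[int]_d -> pedge -> pedge;
  pos_trV : forall n v, pos (trV n v) = pos v + zvec n *m basis;
  trE0 : forall e, trE 0 e = e;
  trED : forall n n' e, trE (n + n') e = trE n (trE n' e);
  src_trE : forall n e, src pgraph (trE n e) = trV n (src pgraph e);
  inv_trE : forall n e, inv pgraph (trE n e) = trE n (inv pgraph e);
  pconnected : connected_graph pgraph;
  pinfinite : infinite_set [set: pvertex];
  plocally_finite : forall v, finite_set [set e | src pgraph e = v];
  pfinite_vertices : exists2 F : set pvertex, finite_set F &
    forall v, exists n u, F u /\ v = trV n u;
  pfinite_edges : exists2 F : set pedge, finite_set F &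
    forall e, exists n u, F u /\ e = trE n u
}.

Section Periodic.
Context {R : realType} {d : nat}.
Variable P : periodic_graph R d.

(* x_A, [v]_A and the fundamental cell Omega *)
Definition coords (x : 'rV[R]_d) : 'rV[R]_d := x *m invmx (basis P).

Definition int_part (v : pvertex P) : 'rV[int]_d :=
  map_mx Num.floor (coords (pos v)).

Definition fundamental_cell : set 'rV[R]_d :=
  [set x | forall s, 0 <= coords x ord0 s < 1].

(* G is the quotient of P by the lattice, through projections whose fibres are
   the orbits; [cellV] identifies the vertices of G with those of P lying in
   the fundamental cell. *)
Record fundamental_graph (V A : finType) (G : mgraph V A) := FundamentalGraph {
  projV : pvertex P -> V;
  projE : pedge P -> A;
  cellV : V -> pvertex P;
  projV_orbit : forall u v, projV u = projV v <-> exists n, v = trV n u;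
  projE_orbit : forall e f, projE e = projE f <-> exists n, f = trE n e;
  projE_surj : forall a, exists e, projE e = a;
  src_projE : forall e, src G (projE e) = projV (src P e);
  inv_projE : forall e, inv G (projE e) = projE (inv P e);
  cellVK : cancel cellV projV;
  cellV_cell : forall v, fundamental_cell (pos (cellV v))
}.

End Periodic.

Section Torus.
Variable R : realType.

Lemma ltrNpipi : - pi < pi :> R.
Proof. by rewrite gtrN ?pi_gt0. Qed.

Definition tuple_cons d (x : measurableTypeR R * d.-tuple (measurableTypeR R)) :
  d.+1.-tuple (measurableTypeR R) := [tuple of x.1 :: x.2].

Lemma measurable_tuple_cons d :
  measurable_fun [set: measurableTypeR R * d.-tuple (measurableTypeR R)]
    (@tuple_cons d).
Proof.
exact: (measurable_cons (f := fst) (g := snd) measurable_fst measurable_snd).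
Qed.

HB.instance Definition _ d := isMeasurableFun.Build _ _
  (measurableTypeR R * d.-tuple (measurableTypeR R))%type
  (d.+1.-tuple (measurableTypeR R)) (@tuple_cons d) (@measurable_tuple_cons d).

(* T^d is represented by the cube [-pi, pi]^d in the space of d-tuples: this is
   the product measure dtheta / (2 pi)^d of that cube, which gives mass 0 to
   the complement of the cube and to its faces. *)
Fixpoint torus d : probability (d.-tuple (measurableTypeR R)) R :=
  match d with
  | 0%N => \d_([tuple] : 0.-tuple (measurableTypeR R))
  | d'.+1 => distribution (uniform_prob ltrNpipi \x torus d')%E (@tuple_cons d')
  end.

End Torus.

Section Operators.
Context {R : realType}.

Definition expi (t : R) : R[i] := (cos t +i* sin t)%C.

Definition normsq (z : R[i]) : R := complex.Re z ^+ 2 + complex.Im z ^+ 2.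

Definition dot {d : nat} (x : 'rV[R]_d) (theta : d.-tuple (measurableTypeR R)) : R :=
  \sum_(s < d) x ord0 s * tnth theta s.

Definition ell2_sqnorm {T : choiceType} (f : T -> R[i]) : \bar R :=
  (\esum_(x in [set: T]) (normsq (f x))%:E)%E.

Definition ell2 {T : choiceType} (f : T -> R[i]) : Prop :=
  (ell2_sqnorm f < +oo)%E.

(* Representatives of the elements of H, the direct integral of l^2(V) over the
   torus; elements of H are classes modulo almost everywhere equality. *)
Section DirectIntegral.
Context {d : nat} {V : finType}.
Implicit Types g h : d.-tuple (measurableTypeR R) -> V -> R[i].

Definition H_sqnorm g : \bar R :=
  (\sum_(v : V) \int[torus R d]_theta (normsq (g theta v))%:E)%E.

Definition in_H g : Prop :=
  (forall v, measurable_fun setT (fun theta => complex.Re (g theta v)) /\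
             measurable_fun setT (fun theta => complex.Im (g theta v))) /\
  (H_sqnorm g < +oo)%E.

Definition eq_H g h : Prop := {ae torus R d, forall theta, g theta =1 h theta}.

(* A map l^2(T) -> H given by its graph; a unitary map is a linear isometry
   of l^2(T) onto H. *)
Definition unitary_graph (T : choiceType)
    (U : (T -> R[i]) -> (d.-tuple (measurableTypeR R) -> V -> R[i]) -> Prop) : Prop :=
  [/\ forall f, ell2 f -> exists g, U f g,
      forall g, in_H g -> exists f, U f g,
      forall f g, U f g -> [/\ ell2 f, in_H g & H_sqnorm g = ell2_sqnorm f] &
      forall (a : R[i]) f g f' g', U f g -> U f' g' ->
        U (fun x => a * f x + f' x)
          (fun theta v => a * g theta v + g' theta v)].

End DirectIntegral.

Section Fiber.
Context {d : nat} {V A : finType}.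
Variables (P : periodic_graph R d) (G : mgraph V A) (Q : fundamental_graph P G).

Definition laplacian (f : pvertex P -> R[i]) (v : pvertex P) : R[i] :=
  \sum_(e \in [set e | src P e = v]) (f v - f (tgt P e)).

(* kappa and tau *)
Definition coordinate_form (kappa : A -> 'rV[R]_d) : Prop :=
  forall e : pedge P, kappa (projE Q e) =
    coords P (pos (tgt P e)) - coords P (pos (src P e)).

Definition index_form (tau : A -> 'rV[R]_d) : Prop :=
  forall e : pedge P, tau (projE Q e) =
    zvec (int_part (tgt P e)) - zvec (int_part (src P e)).

(* Graph of the Gelfand transformation: for f in l^2 the series defining it
   converges unconditionally in L^2. *)
Definition gelfand_sum (f : pvertex P -> R[i]) (F : {fset 'rV[int]_d})
    (theta : d.-tuple (measurableTypeR R)) (v : V) : R[i] :=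
  \sum_(n <- F) expi (- dot (zvec n) theta) * f (trV n (cellV Q v)).

Definition gelfand (f : pvertex P -> R[i])
    (g : d.-tuple (measurableTypeR R) -> V -> R[i]) : Prop :=
  [/\ ell2 f, in_H g &
      forall eps : R, 0 < eps -> exists F0 : {fset 'rV[int]_d},
        forall F : {fset 'rV[int]_d}, (F0 `<=` F)%fset ->
          (H_sqnorm (fun theta v => (g theta v - gelfand_sum f F theta v)%R) < eps%:E)%E].

(* w_b, for a = tau - b and base vertex v0; the sum over a walk does not depend
   on the walk. *)
Definition gauge_potential (v0 : V) (a : A -> 'rV[R]_d) (w : V -> 'rV[R]_d) : Prop :=
  forall p v, walk G v0 p v -> w v = \sum_(e <- p) a e.

Definition gauge (w : V -> 'rV[R]_d)
    (g : d.-tuple (measurableTypeR R) -> V -> R[i]) :=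
  fun theta v => expi (dot (w v) theta) * g theta v.

Definition gauge_gelfand (w : V -> 'rV[R]_d) (f : pvertex P -> R[i])
    (g : d.-tuple (measurableTypeR R) -> V -> R[i]) : Prop :=
  exists2 g0, gelfand f g0 & g = gauge w g0.

(* The forms kappa, tau and the function w are uniquely determined, the last
   one by b and the base vertex v0. The last clause says that the graph of
   U Delta U^-1 on H is that of the direct integral of B. *)
Definition fiber_operator (v0 : V)
    (B : d.-tuple (measurableTypeR R) -> (V -> R[i]) -> V -> R[i]) : Prop :=
  exists kappa tau b w,
    [/\ coordinate_form kappa, index_form tau, same_flux G kappa b,
        gauge_potential v0 (fun e => tau e - b e) w &
        unitary_graph (gauge_gelfand w) /\
        forall g h, in_H g -> in_H h ->
          ((exists2 f, gauge_gelfand w f g & gauge_gelfand w (laplacian f) h) <->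
           eq_H h (fun theta => B theta (g theta)))].

End Fiber.

(* The sum over oriented edges leaving v counts a loop twice, once for each
   orientation. *)
Definition form_operator {d : nat} {V A : finType} (G : mgraph V A)
    (b : A -> 'rV[R]_d) (theta : d.-tuple (measurableTypeR R))
    (f : V -> R[i]) (v : V) : R[i] :=
  #|[set e | src G e == v]%SET|%:R * f v -
  \sum_(e : A | src G e == v) expi (dot (b e) theta) * f (tgt G e).

End Operators.

(* Main.v *)
Require Import Defs.
From HB Require Import structures.
From mathcomp Require Import all_boot all_order all_algebra finmap.
From mathcomp Require Import all_classical all_reals all_analysis.
From mathcomp.real_closed Require Import complex.
From mathcomp Require Import measurable_realfun.
From mathcomp Require Import ring lra.

Set Implicit Arguments.
Unset Strict Implicit.
Unset Printing Implicit Defensive.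

Import Order.TTheory GRing.Theory Num.Theory.
Import numFieldNormedType.Exports.

Local Open Scope classical_set_scope.
Local Open Scope ring_scope.

(** Fix a root [r] and let [phi v] be the sum of [m] along a chosen walk from
[r] to [v].  Then [m e + phi (src e) - phi (tgt e)] is the flux of a closed walk,
hence an integer vector [t e]: up to a gradient, [m] is an integral form
([integer_form]).  The form [t] is the recipe for a periodic graph
([lattice_cover]) on [V * Z^d]: the edge [e] is lifted to edges from
[(src e, n)] to [(tgt e, n + t e)].  This graph is connected because the fluxes
of closed walks at [r] exhaust Z^d.  Putting [(v, n)] at the point [n] plus a
vector of the unit cell depending on [v] makes [t] the index form, and it makes
the coordinate form differ from [m] by a gradient, so [m] has the right fluxes.

The Gelfand transformation turns the translation by [t e] into the
multiplication by [exp (i <t e, theta>)] ([fourier_shift]), so that the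
Laplacian becomes the operator with exponents [t] ([gelfand_laplacian]).  The
gauge function is [phi v0 - phi v], and conjugating by it replaces [t] by [m]
([form_operator_gauge]).

It remains to see that the transformation is unitary onto the direct integral.
For each vertex this is the statement that the characters of the torus form an
orthonormal basis of L2, together with the completeness of L2 that is needed to
sum a square summable series of characters.  The latter is the Riesz-Fischer
argument of [L2_fast_cauchy_cvg].  For an orthonormal system of functions of
modulus 1, everything else follows from one identity, the change of the norm
when a multiple of one basis function is subtracted ([rsqnorm_sub]): it gives
Bessel, Parseval and the coefficients of a sum.

Completeness of the characters is proved in the form that an integrable [u]
whose integrals against all trigonometric polynomials vanish is zero almost
everywhere ([torus_fourier_unique]).  The functions annihilated by [u] are
closed under bounded pointwise limits.  Iterating the cubic [(3 x - x^3) / 2]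
on a trigonometric polynomial [p] bounded by 1 converges pointwise to the sign
of [p], so the indicator of [p > 0] is annihilated; taking for [p] a shifted
cosine gives arcs, products of arcs give boxes, and boxes generate the Borel
sets. *)

(** * Integration over the torus *)

Lemma integrable_mul_bounded (R : realType) (disp : measure_display)
    (T : measurableType disp) (mu : {measure set T -> \bar R}) (u h : T -> R) M :
  mu.-integrable setT (EFin \o u) -> measurable_fun setT h ->
  (forall t, `|h t| <= M) ->
  mu.-integrable setT (EFin \o (fun t => u t * h t)).
Proof.
move=> ui mh hM.
have bh : [bounded h t | t in setT].
  exists M; split; first exact: num_real.
  by move=> x Mx t _; rewrite /= (le_trans (hM t)) // ltW.
exact: (integrableMl measurableT ui mh bh).
Qed.

Section TorusIntegral.
Variable R : realType.

Local Notation pt d := (d.-tuple (measurableTypeR R)).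
Lemma sinD_int2pi (x : R) (k : int) : sin (x + k%:~R * pi *+ 2) = sin x.
Proof.
have H (n : nat) (y : R) : sin (y + n%:R * pi *+ 2) = sin y.
  by rewrite -mulrnAr mulr_natl (periodicn (@sinD2pi R)).
case: k => n; first exact: H.
by rewrite NegzE rmorphN /= mulNr mulNrn -[LHS](H n.+1) subrK.
Qed.

(** Adding 1 keeps the integrand nonnegative, so that the integral over the
uniform law, and later Tonelli, apply without integrability conditions. *)
Lemma uniform_cos (s : R) (k : int) :
  (\int[uniform_prob (ltrNpipi R)]_t (1 + cos (s + k%:~R * t))%:E =
    (1 + (k == 0)%:R * cos s)%:E)%E.
Proof.
have cF (t : R) : {for t, continuous (fun t : R => s + k%:~R * t)}.
  by apply: cvgD; [exact: cvg_cst|apply: cvgM; [exact: cvg_cst|exact: cvg_id]].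
have cf : continuous (fun t : R => 1 + cos (s + k%:~R * t)).
  move=> t; apply: cvgD; first exact: cvg_cst.
  apply: (@continuous_comp _ _ _ (fun t : R => s + k%:~R * t) cos) => //.
  exact: continuous_cos.
rewrite integral_uniform; last 2 first.
- by apply/measurable_EFinP; exact: continuous_measurable_fun.
- by move=> x; rewrite lee_fin; have := cos_geN1 (s + k%:~R * x); lra.
pose F (t : R) := t + (if k == 0 then t * cos s else sin (s + k%:~R * t) / k%:~R).
have dF (t : R) : is_derive t (1 : R) F (1 + cos (s + k%:~R * t)).
  rewrite /F; case: eqVneq => [->|k0].
    by apply: is_derive_eq; rewrite mul0r addr0 scaler0 add0r -[_ *: _]/(_ * _) mulr1.
  have kR0 : k%:~R != 0 :> R by rewrite intr_eq0.
  apply: is_derive_eq.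
  by rewrite !scaler0 !add0r mul1r -![_ *: _]/(_ * _); field.
transitivity ((pi - - pi)^-1%:E * ((F pi)%:E - (F (- pi))%:E) : \bar R)%E.
  congr (_ * _)%E; apply: continuous_FTC2 => //; first exact: ltrNpipi.
  - exact: continuous_subspaceT.
  - split.
    + by move=> x _; exact: ex_derive.
    + apply: cvg_at_right_filter; apply: differentiable_continuous.
      by apply/derivable1_diffP; exact: ex_derive.
    + apply: cvg_at_left_filter; apply: differentiable_continuous.
      by apply/derivable1_diffP; exact: ex_derive.
  - by move=> x _; rewrite derive1E; exact: derive_val.
rewrite -EFinB -EFinM; congr EFin; rewrite /F.
have pi0 : pi != 0 :> R by rewrite gt_eqF ?pi_gt0.
have dbl (p : R) : p != 0 -> p - - p != 0.
  by move=> p0; rewrite opprK -mulr2n mulrn_eq0 (negbTE p0).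
have flat (p c : R) : p != 0 ->
    (p - - p)^-1 * (p + p * c - (- p + - p * c)) = 1 + 1 * c.
  by move=> p0; have pp := dbl p p0; apply: (mulfI pp); rewrite mulrA mulfV //; ring.
have slope (p c : R) : p != 0 -> (p - - p)^-1 * (p + c - (- p + c)) = 1.
  by move=> p0; have pp := dbl p p0; apply: (mulfI pp); rewrite mulrA mulfV //; ring.
case: eqVneq => [_|k0] /=; first exact: flat.
rewrite mul0r addr0.
have -> : sin (s + k%:~R * pi) = sin (s + k%:~R * (- pi) : R).
  by rewrite -[RHS](sinD_int2pi _ k) mulrN mulr2n addrA subrK.
exact: slope.
Qed.

Definition phase d (k : 'I_d -> int) (th : pt d) : R :=
  \sum_(i < d) (k i)%:~R * tnth th i.

Lemma measurable_phase d (k : 'I_d -> int) : measurable_fun setT (phase k).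
Proof.
apply: measurable_sum => i.
by apply: measurable_funM => //; exact: measurable_tnth.
Qed.

Lemma measurable_cos_phase d (k : 'I_d -> int) (s : R) :
  measurable_fun setT (fun th => cos (s + phase k th)).
Proof.
apply: measurableT_comp.
  by apply: continuous_measurable_fun; exact: continuous_cos.
by apply: measurable_funD => //; exact: measurable_phase.
Qed.

Lemma phase_cons d (k : 'I_d.+1 -> int) x :
  phase k (tuple_cons x) = (k ord0)%:~R * x.1 + phase (k \o lift ord0) x.2.
Proof.
rewrite /phase big_ord_recl tnth0; congr (_ + _).
by apply: eq_bigr => i _; rewrite tnthS.
Qed.

Lemma ge0_integral_torusS d (f : pt d.+1 -> \bar R) :
  measurable_fun setT f -> (forall th, 0 <= f th)%E ->
  (\int[torus R d.+1]_th f th =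
   \int[uniform_prob (ltrNpipi R)]_t \int[torus R d]_th f (tuple_cons (t, th)))%E.
Proof.
move=> mf f0.
have -> : (\int[torus R d.+1]_th f th =
    \int[uniform_prob (ltrNpipi R) \x torus R d]_x (f \o @tuple_cons R d) x)%E.
  by rewrite -[in RHS](preimage_setT (@tuple_cons R d)); exact: ge0_integral_pushforward.
rewrite fubini_tonelli1 //.
- by apply: measurableT_comp => //; exact: measurable_tuple_cons.
- by move=> x; exact: f0.
Qed.

(** The phase [s] is what makes the induction on the dimension immediate: after
integrating all but one coordinate, the remaining one only shifts [s]. *)
Lemma torus_1cos d (k : 'I_d -> int) (s : R) :
  (\int[torus R d]_th (1 + cos (s + phase k th))%:E =
    (1 + [forall i, k i == 0]%:R * cos s)%:E)%E.
Proof.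
elim: d k s => [|d IH] k s.
  rewrite integral_dirac //=.
    rewrite diracT mul1e /phase big_ord0 addr0; congr (1 + _)%:E.
    by case: forallP => [|[]]; [rewrite mul1r|case].
  by apply/measurable_EFinP; apply: measurable_funD => //; exact: measurable_cos_phase.
have nn (x : R) : 0 <= 1 + cos x by have := cos_geN1 x; lra.
rewrite ge0_integral_torusS; last 2 first.
- by apply/measurable_EFinP; apply: measurable_funD => //; exact: measurable_cos_phase.
- by move=> y; rewrite lee_fin.
under eq_integral => x _.
  under eq_integral => y _ do rewrite /= phase_cons addrA /=.
  rewrite IH.
  over.
rewrite /=.
have [k'0|k'0] := boolP [forall i, (k \o lift ord0) i == 0].
  under eq_integral => x _ do rewrite mul1r.
  rewrite uniform_cos; congr (1 + _%:R * _)%:E.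
  congr nat_of_bool; apply/eqP/forallP => [k0 i|/(_ ord0)/eqP//].
  by case: (unliftP ord0 i) => [j|] ->; [exact: (forallP k'0)|exact/eqP].
under eq_integral => x _ do rewrite mul0r addr0.
rewrite integral_cst //= probability_setT mule1; congr EFin.
have /negbTE-> : ~~ [forall i, k i == 0].
  by apply: contra k'0 => /forallP k0; apply/forallP => i; exact: k0.
by rewrite mul0r addr0.
Qed.

Lemma uniform_open_itv :
  uniform_prob (ltrNpipi R) `]- pi, pi[ = 1%E.
Proof.
rewrite /uniform_prob integral_uniform_pdf setIidl; last first.
  by apply: subset_itv; rewrite bnd_simp.
rewrite (eq_integral (fun=> (pi - - pi)^-1%:E)); last first.
  by move=> x; rewrite inE/= in_itv/= /uniform_pdf => /andP[/ltW-> /ltW->].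
rewrite integral_cst//= lebesgue_measure_itv/= lte_fin ltrNpipi.
by rewrite -EFinD -EFinM mulVf// gt_eqF// subr_gt0 ltrNpipi.
Qed.

Definition open_cube d : set (pt d) := [set th | forall i, - pi < tnth th i < pi].
Arguments open_cube : clear implicits.

Lemma measurable_open_cube d : measurable (open_cube d).
Proof.
have -> : open_cube d = \bigcap_(i in [set: 'I_d]) ((@tnth _ _)^~ i @^-1` `]- pi, pi[).
  apply/seteqP; split => th /= H i; first by move=> _; rewrite /= in_itv; exact: H.
  by have := H i I; rewrite /= in_itv.
apply: fin_bigcap_measurable => // i _.
by rewrite -[X in measurable X]setTI; exact: measurable_tnth.
Qed.

Lemma torus_open_cube d : torus R d (open_cube d) = 1%E.
Proof.
elim: d => [|d IH].
  by rewrite (_ : open_cube 0 = setT) ?probability_setT //; apply/seteqP; split=> // x _ [].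
transitivity ((uniform_prob (ltrNpipi R) \x torus R d)%E (`]- pi, pi[ `*` open_cube d)).
  rewrite (_ : `]- pi, pi[ `*` open_cube d =
    @tuple_cons R d @^-1` open_cube d.+1) //.
  apply/seteqP; split => -[t th] /=; last first.
    move=> H; split; first by have := H ord0; rewrite tnth0 /= in_itv.
    by move=> i; have := H (lift ord0 i); rewrite tnthS.
  rewrite in_itv /= => -[tI H] i.
  by case: (unliftP ord0 i) => [j|] ->; rewrite (tnth0, tnthS) //; exact: H.
transitivity (uniform_prob (ltrNpipi R) `](- pi)%R, pi%R[ * torus R d (open_cube d))%E.
  by apply: product_measure1E => //; exact: measurable_open_cube.
by rewrite IH mule1; exact: uniform_open_itv.
Qed.

(** Trigonometric polynomials do not distinguish corresponding points of opposite
faces of the cube, so the faces have to be discarded. *)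
Lemma ae_open_cube d : {ae torus R d, forall th, open_cube d th}.
Proof.
exists (~` open_cube d); split => //.
  by apply: measurableC; exact: measurable_open_cube.
by rewrite probability_setC ?torus_open_cube ?subee //; exact: measurable_open_cube.
Qed.

End TorusIntegral.
Arguments open_cube {R} d.

(** * Trigonometric polynomials and their bounded limits *)

Section TrigPoly.
Variable R : realType.
Variable d : nat.

Local Notation pt := (d.-tuple (measurableTypeR R)).

Inductive trigpoly : (pt -> R) -> Prop :=
| trigpoly_cos k s : trigpoly (fun th => cos (s + phase k th))
| trigpoly_lin c p q : trigpoly p -> trigpoly q ->
    trigpoly (fun th => c * p th + q th).

Lemma phaseD (k l : 'I_d -> int) (th : pt) :
  phase (fun i => k i + l i) th = phase k th + phase l th.
Proof.
by rewrite /phase -big_split; apply: eq_bigr => i _; rewrite rmorphD mulrDl.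
Qed.

Lemma phaseN (k : 'I_d -> int) (th : pt) :
  phase (fun i => - k i) th = - phase k th.
Proof.
by rewrite /phase -sumrN; apply: eq_bigr => i _; rewrite rmorphN mulNr.
Qed.

Lemma trigpoly_ext p q : p =1 q -> trigpoly p -> trigpoly q.
Proof. by move=> /funext->. Qed.

Lemma trigpoly_cst c : trigpoly (fun=> c).
Proof.
have t1 := trigpoly_cos (fun=> 0) 0.
apply: trigpoly_ext (trigpoly_lin (c - 1) t1 t1) => th.
rewrite /phase big1 ?addr0 ?cos0; first by ring.
by move=> i _; rewrite mul0r.
Qed.

Lemma trigpolyZ c p : trigpoly p -> trigpoly (fun th => c * p th).
Proof.
move=> tp; apply: trigpoly_ext (trigpoly_lin c tp (trigpoly_cst 0)) => th.
by rewrite addr0.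
Qed.

Lemma trigpolyD p q : trigpoly p -> trigpoly q -> trigpoly (fun th => p th + q th).
Proof.
move=> tp tq; apply: trigpoly_ext (trigpoly_lin 1 tp tq) => th.
by rewrite mul1r.
Qed.

Lemma trigpolyM p q : trigpoly p -> trigpoly q -> trigpoly (fun th => p th * q th).
Proof.
move=> tp; elim: tp q => [k s|c p1 p2 _ IH1 _ IH2] q tq; last first.
  apply: trigpoly_ext (trigpoly_lin c (IH1 _ tq) (IH2 _ tq)) => th; ring.
elim: tq => [l t|c q1 q2 _ IH1 _ IH2]; last first.
  by apply: trigpoly_ext (trigpoly_lin c IH1 IH2) => th; ring.
have tD := trigpolyZ 2^-1 (trigpoly_cos (fun i => k i + l i) (s + t)).
have tB := trigpolyZ 2^-1 (trigpoly_cos (fun i => k i + - l i) (s - t)).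
apply: trigpoly_ext (trigpolyD tD tB) => th.
rewrite !phaseD phaseN (addrACA s t) (addrACA s (- t)) -opprD.
by rewrite (cosD (s + _)) (cosB (s + _)); field.
Qed.

Lemma measurable_trigpoly p : trigpoly p -> measurable_fun setT p.
Proof.
elim=> [k s|c p1 p2 _ IH1 _ IH2]; first exact: measurable_cos_phase.
by apply: measurable_funD => //; exact: measurable_funM.
Qed.

Lemma trigpoly_bounded p : trigpoly p -> exists M, forall th, `|p th| <= M.
Proof.
elim=> [k s|c p1 p2 _ [M1 H1] _ [M2 H2]].
  by exists 1 => th; rewrite ler_norml cos_geN1 cos_le1.
exists (`|c| * M1 + M2) => th.
by rewrite (le_trans (ler_normD _ _)) // lerD // normrM ler_wpM2l.
Qed.

(** Its fixed points are -1, 0 and 1, and 0 is repelling; the iterates of a point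
of [-1, 1] converge to its sign.  Being a polynomial, it preserves the algebra
of trigonometric polynomials. *)
Definition sgn_step (x : R) := (3 * x - x ^+ 3) / 2.

(** The factorizations [1 - q y = (1 - y)^2 (2 + y) / 2] and
[q y - y = y (1 - y) (1 + y) / 2] for [q := sgn_step] show that the iterates
increase and approach 1 at a geometric rate. *)
Lemma sgn_step_pos x n : 0 < x <= 1 ->
  x <= iter n sgn_step x <= 1 /\ 1 - iter n sgn_step x <= (1 - x / 2) ^+ n.
Proof.
move=> x01; elim: n => [|n [/andP[IH1 IH2] IH3]] /=.
  by rewrite expr0; split; lra.
set y := iter n sgn_step x in IH1 IH2 IH3 *.
have E : 1 - sgn_step y = (1 - y) * ((1 - y) * (2 + y) / 2).
  by rewrite /sgn_step; field.
have F : sgn_step y - y = y * (1 - y) * (1 + y) / 2.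
  by rewrite /sgn_step; field.
have G : 0 <= y * (1 - y) * (1 + y) by rewrite !mulr_ge0 //; lra.
have H : 0 <= (1 - y) * (1 - y) * (2 + y) by rewrite !mulr_ge0 //; lra.
split; first by apply/andP; split; nra.
rewrite exprSr E ler_pM //; [lra|nra|nra].
Qed.

Lemma sgn_stepN n x : iter n sgn_step (- x) = - iter n sgn_step x.
Proof.
by elim: n => [//|n /= ->]; rewrite /sgn_step; field.
Qed.

Lemma sgn_step_norm x n : `|x| <= 1 -> `|iter n sgn_step x| <= 1.
Proof.
have pos y : 0 < y <= 1 -> `|iter n sgn_step y| <= 1.
  by move=> y01; have [] := sgn_step_pos n y01; rewrite ler_norml; lra.
have [x0|x0|->] := ltgtP x 0; rewrite ler_norml => x1.
- by rewrite -[x]opprK sgn_stepN normrN; apply: pos; lra.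
- by apply: pos; lra.
- suff -> : iter n sgn_step 0 = 0 by rewrite normr0.
  by elim: n {pos} => [//|n /= ->]; rewrite /sgn_step; field.
Qed.

Lemma sgn_step_cvg x : `|x| <= 1 -> iter n sgn_step x @[n --> \oo] --> Num.sg x.
Proof.
have pos y : 0 < y <= 1 -> iter n sgn_step y @[n --> \oo] --> (1 : R).
  move=> y01; apply: (@squeeze_cvgr _ _ _ _ (fun n => 1 - (1 - y / 2) ^+ n) (fun=> 1)).
  - near=> n; have [] := sgn_step_pos n y01; lra.
  - rewrite -[X in _ --> X]subr0; apply: cvgB; first exact: cvg_cst.
    by apply: cvg_expr; rewrite ger0_norm; lra.
  - exact: cvg_cst.
have [x0|x0|->] := ltgtP x 0; rewrite ler_norml => x1.
- have -> : (fun n => iter n sgn_step x) = (fun n => - iter n sgn_step (- x)).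
    by apply/funext => n; rewrite sgn_stepN opprK.
  by rewrite ltr0_sg //; apply: cvgN; apply: pos; lra.
- by rewrite gtr0_sg //; apply: pos; lra.
- have -> : (fun n => iter n sgn_step 0) = (fun=> 0).
    by apply/funext; elim=> [//|n /= ->]; rewrite /sgn_step; field.
  by rewrite sgr0; exact: cvg_cst.
Unshelve. all: by end_near. Qed.

Definition trig_limit (h : pt -> R) := exists p : nat -> pt -> R,
  [/\ forall n, trigpoly (p n), forall n th, `|p n th| <= 1 &
      forall th, p n th @[n --> \oo] --> h th].

Lemma trig_limit1 : trig_limit (fun=> 1).
Proof.
exists (fun _ _ => 1); split=> [n|n th|th]; first exact: trigpoly_cst.
  by rewrite normr1.
exact: cvg_cst.
Qed.

Lemma trig_limitM g h : trig_limit g -> trig_limit h ->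
  trig_limit (fun th => g th * h th).
Proof.
move=> [p [tp bp cp]] [q [tq bq cq]]; exists (fun n th => p n th * q n th).
split=> [n|n th|th]; first exact: trigpolyM.
  by rewrite normrM mulr_ile1.
exact: cvgM.
Qed.

(** With [s] the sign of [p], the indicator of [0 < p] is [(s^2 + s) / 2]; the
square removes the value 1/2 which [(s + 1) / 2] takes where [p] vanishes. *)
Lemma trig_limit_gt0 p : trigpoly p -> (forall th, `|p th| <= 1) ->
  trig_limit (fun th => (0 < p th)%R%:R).
Proof.
move=> tp p1; pose s n th := iter n sgn_step (p th).
have ts n : trigpoly (s n).
  elim: n => [//|n IH].
  have t3 := trigpolyM IH (trigpolyM IH IH).
  apply: trigpoly_ext (trigpoly_lin (3 / 2) IH (trigpolyZ (- 2^-1) t3)) => th.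
  by rewrite /s /= /sgn_step; field.
exists (fun n th => 2^-1 * (s n th * s n th) + 2^-1 * s n th); split=> [n|n th|th].
- exact: trigpolyD (trigpolyZ _ (trigpolyM (ts n) (ts n))) (trigpolyZ _ (ts n)).
- have : `|s n th| <= 1 by exact: sgn_step_norm.
  by rewrite !ler_norml => /andP[? ?]; nra.
- have cs := sgn_step_cvg (p1 th).
  rewrite (_ : (_ : bool)%:R = 2^-1 * (Num.sg (p th) * Num.sg (p th)) + 2^-1 * Num.sg (p th)).
    by apply: cvgD; (apply: cvgM; first exact: cvg_cst) => //; exact: cvgM.
  by case: (ltgtP (p th) 0) => [lt|gt|->];
    [rewrite ltr0_sg //|rewrite gtr0_sg //|rewrite sgr0]; rewrite /=; field.
Qed.


Lemma measurable_trig_limit h : trig_limit h -> measurable_fun setT h.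
Proof.
move=> [p [tp _ cp]]; apply: (measurable_fun_cvg (h := p)) => [n|th _]; last exact: cp.
exact: measurable_trigpoly.
Qed.

Lemma trig_limit_norm h : trig_limit h -> forall th, `|h th| <= 1.
Proof.
move=> [p [_ bp cp]] th.
have cn : `|p n th| @[n --> \oo] --> `|h th| by apply: cvg_norm; exact: cp.
rewrite -(cvg_lim _ cn) //; apply: limr_le; last by apply: nearW => n; exact: bp.
by apply/cvg_ex; eexists; exact: cn.
Qed.

Section Annihilator.
Variable u : pt -> R.
Hypothesis ui : (torus R d).-integrable setT (EFin \o u).
Hypothesis u_cos : forall k s,
  \int[torus R d]_th (u th * cos (s + phase k th)) = 0.

Lemma trigpoly_ann p : trigpoly p -> \int[torus R d]_th (u th * p th) = 0.
Proof.
elim=> [//|c p1 p2 tp1 IH1 tp2 IH2].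
have it q : trigpoly q ->
    (torus R d).-integrable setT (EFin \o (fun th => u th * q th)).
  move=> tq; have [M bM] := trigpoly_bounded tq.
  exact: integrable_mul_bounded ui (measurable_trigpoly tq) bM.
under eq_Rintegral => th _ do rewrite mulrDr mulrCA.
rewrite RintegralD // ?RintegralZl // ?IH1 ?IH2 ?mulr0 ?addr0 //; first exact: it.
  by apply: (integrableZl _ c (it _ tp1)).
exact: it.
Qed.

(** Dominated convergence, with the absolute value of [u] as dominating
function. *)
Lemma trig_limit_ann h : trig_limit h -> \int[torus R d]_th (u th * h th) = 0.
Proof.
move=> th_h; have [p [tp bp cp]] := th_h.
have mu_ : measurable_fun setT u by apply/measurable_EFinP; exact: measurable_int ui.
have [] := @dominated_convergence _ _ _ (torus R d) setT measurableT
  (fun n th => (u th * p n th)%:E) (fun th => (u th * h th)%:E) (fun th => `|u th|%:E).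
- by move=> n; apply/measurable_EFinP; apply: measurable_funM => //; exact: measurable_trigpoly.
- by apply/measurable_EFinP; apply: measurable_funM => //; exact: measurable_trig_limit.
- apply: aeW => th _; apply: cvg_EFin; first exact: nearW.
  by apply: cvgM; [exact: cvg_cst|exact: cp].
- exact: integrable_norm.
- apply: aeW => th n _; rewrite lee_fin normrM ler_piMr //.
- move=> _ _ /=; rewrite /Rintegral.
  rewrite (_ : (fun n => _) = (fun=> 0%E)).
    move=> /cvg_lim <- //; first by rewrite lim_cst.
  apply/funext => n; have := trigpoly_ann (tp n).
  rewrite /Rintegral => E; rewrite -[LHS]fineK ?E //.
  apply: integrable_fin_num => //.
  exact: integrable_mul_bounded ui (measurable_trigpoly (tp n)) (bp n).
Qed.

End Annihilator.

End TrigPoly.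

(** * Completeness of the characters *)

Section Boxes.
Variable R : realType.
Variable d : nat.

Local Notation pt := (d.-tuple (measurableTypeR R)).

(** The full line is included in order to have the preimages of rays under a
single coordinate among the boxes. *)
Definition ray_or_line (I : set R) := I = setT \/ exists x, I = `]-oo, x[%classic.

Definition box (I : 'I_d -> set R) : set pt := [set th | forall i, I i (tnth th i)].

Definition boxes : set (set pt) :=
  [set box I | I in [set I | forall i, ray_or_line (I i)]].

Lemma boxes_setI_closed : setI_closed boxes.
Proof.
move=> _ _ [I rI <-] [J rJ <-]; exists (fun i => I i `&` J i); last first.
  by apply/seteqP; split=> th /=; [move=> H; split=> i; case: (H i)|move=> [? ?] i; split].
move=> i; case: (rI i) => [->|[x ->]]; first by rewrite setTI; exact: rJ.
case: (rJ i) => [->|[y ->]]; first by right; exists x; rewrite setIT.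
right; exists (Num.min x y); apply/seteqP; split=> z /=; rewrite !in_itv /= lt_min.
  by case=> -> ->.
by move=> /andP.
Qed.

Lemma measurable_ray_or_line (I : set R) :
  ray_or_line I -> measurable (I : set (measurableTypeR R)).
Proof. by case=> [->|[x ->]]. Qed.

Lemma measurable_box I : (forall i, ray_or_line (I i)) -> measurable (box I).
Proof.
move=> rI; have -> : box I = \bigcap_(i in [set: 'I_d]) ((@tnth _ _)^~ i @^-1` I i).
  by apply/seteqP; split => th /= H i; [move=> _; exact: H|exact: (H i Logic.I)].
apply: fin_bigcap_measurable => // i _.
rewrite -[X in measurable X]setTI; apply: measurable_tnth => //.
exact: measurable_ray_or_line.
Qed.

Lemma measurable_boxesE : @measurable _ pt = <<s boxes >>.
Proof.
apply/seteqP; split; last first.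
  apply: smallest_sub; first exact: sigma_algebra_measurable.
  by move=> _ [I rI <-]; exact: measurable_box.
apply: smallest_sub; first exact: smallest_sigma_algebra.
move=> A; rewrite -bigcup_seq => -[i _ [B mB <-]]; rewrite setTI.
pose H : set (set R) := [set B | <<s boxes >> ((@tnth d R)^~ i @^-1` B)].
have sH : sigma_algebra setT H.
  split.
  - by rewrite /H /= preimage_set0; exact: sigma_algebra0.
  - by move=> C HC; rewrite /H /= setTD preimage_setC; exact: sigma_algebraC.
  - by move=> F HF; rewrite /H /= preimage_bigcup; exact: sigma_algebra_bigcup.
suff : measurable (B : set (measurableTypeR R)) -> H B by apply.
move=> {}mB; have : <<s RGenInftyO.G (R:=R) >> B.
  have GE : @measurable _ (measurableTypeR R) = <<s RGenInftyO.G (R:=R) >>.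
    exact: RGenInftyO.measurableE.
  by rewrite -GE.
move: B {mB}; apply: smallest_sub => // C [x ->]; rewrite /H /=.
apply: sub_sigma_algebra; exists (fun j => if j == i then `]-oo, x[%classic else setT).
  by move=> j /=; case: ifP => _; [right; exists x|left].
apply/seteqP; split=> th /=; first by move=> /(_ i); rewrite eqxx.
by move=> ti j; case: eqP => [->|].
Qed.

(** The difference of the cosines is twice the product of [sin ((x + pi) / 2)],
which is positive, and [sin ((b - x) / 2)], which has the sign of [b - x]. *)
Lemma arc_indicator (x b : R) : - pi < x < pi -> - pi <= b <= pi ->
  (0 < cos (x - (b - pi) / 2) - cos ((b + pi) / 2)) = (x < b).
Proof.
move=> /andP[x1 x2] /andP[b1 b2].
have -> : cos (x - (b - pi) / 2) - cos ((b + pi) / 2) =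
    2 * (sin ((x + pi) / 2) * sin ((b - x) / 2)).
  have -> : x - (b - pi) / 2 = (x + pi) / 2 - (b - x) / 2 by rewrite -!mulrBl; lra.
  have -> : (b + pi) / 2 = (x + pi) / 2 + (b - x) / 2 by rewrite -!mulrDl; lra.
  by rewrite cosB cosD; move: (cos _) (cos _) (sin _) (sin _) => *; ring.
have s0 : 0 < sin ((x + pi) / 2) by apply: sin_gt0_pi; apply/andP; split; lra.
rewrite pmulr_rgt0 // pmulr_rgt0 //.
have [xb|xb] := ltP x b; first by apply: sin_gt0_pi; apply/andP; split; lra.
rewrite -[(b - x) / 2]opprK sinN oppr_gt0; apply/negbTE; rewrite -leNgt.
by apply: sin_ge0_pi; apply/andP; split; lra.
Qed.

Lemma ray_or_line_trig_limit (I : set R) (i : 'I_d) : ray_or_line I ->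
  exists2 h : pt -> R, trig_limit h &
    forall th, open_cube d th -> h th = \1_I (tnth th i).
Proof.
case=> [->|[x ->]].
  by exists (fun=> 1); [exact: trig_limit1|move=> th _; rewrite indicE in_setT].
(* The ray meets the open interval ]- pi, pi[ in the arc ]- pi, b[. *)
pose b := Num.max (- pi) (Num.min x pi).
have pi0 := pi_gt0 R.
have bpi : - pi <= b <= pi.
  by rewrite /b le_max lexx ge_max ge_min lexx orbT /=; lra.
pose k (j : 'I_d) : int := (j == i).
have kE (th : pt) : phase k th = tnth th i.
  rewrite /phase (bigD1 i) //= /k eqxx mul1r big1 ?addr0 // => j /negbTE ->.
  by rewrite mul0r.
pose p (th : pt) := 2^-1 * (cos (- ((b - pi) / 2) + phase k th)) + - cos ((b + pi) / 2) / 2.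
have tp : trigpoly p.
  exact: trigpoly_lin (trigpoly_cos _ _) (trigpoly_cst _ _).
exists (fun th => (0 < p th)%R%:R).
  apply: trig_limit_gt0 => // th; rewrite /p.
  have := cos_geN1 ((b + pi) / 2); have := cos_le1 ((b + pi) / 2).
  have := cos_geN1 (- ((b - pi) / 2) + phase k th).
  have := cos_le1 (- ((b - pi) / 2) + phase k th).
  by move: (cos _) (cos _) => y z *; rewrite ler_norml; apply/andP; split; lra.
move=> th cth; rewrite indicE mem_setE /= in_itv /=; congr (nat_of_bool _)%:R.
have -> : (0 < p th) = (0 < cos (tnth th i - (b - pi) / 2) - cos ((b + pi) / 2)).
  rewrite /p kE (addrC (- _)); move: (cos _) (cos _) => y z.
  by apply/idP/idP; lra.
rewrite arc_indicator //.
have /andP[c1 c2] := cth i.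
by rewrite /b lt_max lt_min c2 andbT (lt_gtF c1).
Qed.

Lemma trig_limit_prod (h : 'I_d -> pt -> R) : (forall i, trig_limit (h i)) ->
  trig_limit (fun th => \prod_i h i th).
Proof.
move=> th_h; rewrite (_ : (fun th => _) = \big[(fun f g th => f th * g th)/(fun=> 1)]_i h i).
  elim/big_ind: _ => [|f g tf tg|i _]; [exact: trig_limit1|exact: trig_limitM|exact: th_h].
apply/funext => th; elim/big_rec2: _ => [//|i f g _ IH].
by rewrite -IH.
Qed.


(** The sets over which the integral of [u] vanishes form a Dynkin system.  It
contains the boxes: on the open cube their indicators are products of
indicators of arcs, which are bounded limits of trigonometric polynomials. *)
Lemma torus_fourier_unique (u : pt -> R) :
  (torus R d).-integrable setT (EFin \o u) ->
  (forall k s, \int[torus R d]_th (u th * cos (s + phase k th)) = 0) ->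
  {ae torus R d, forall th, u th = 0}.
Proof.
move=> ui u_cos.
have mu_ : measurable_fun setT u by apply/measurable_EFinP; exact: measurable_int ui.
have int_box B : boxes B -> (\int[torus R d]_(th in B) (u th)%:E = 0)%E.
  move=> [I rI <-].
  have /choice [h hP] : forall i, exists h : pt -> R, trig_limit h /\
      forall th, open_cube d th -> h th = \1_(I i) (tnth th i).
    by move=> i; have [h ? ?] := ray_or_line_trig_limit i (rI i); exists h.
  have tH : trig_limit (fun th => \prod_i h i th).
    by apply: trig_limit_prod => i; case: (hP i).
  have iH := integrable_mul_bounded ui (measurable_trig_limit tH) (trig_limit_norm tH).
  have := trig_limit_ann ui u_cos tH; rewrite /Rintegral => E.
  rewrite integral_mkcond.
  rewrite -[RHS](_ : (\int[torus R d]_th (u th * \prod_i h i th)%:E = 0)%E); last first.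
    by rewrite -[LHS]fineK ?E //; exact: integrable_fin_num iH.
  apply: ae_eq_integral => //.
  - apply/(measurable_restrictT _ (measurable_box rI)).
    by apply/measurable_EFinP; exact: measurable_funTS.
  - exact: measurable_int iH.
  - apply: filterS (ae_open_cube R d) => th cth _.
    rewrite patchE (eq_bigr (fun i => \1_(I i) (tnth th i))); last first.
      by move=> i _; case: (hP i) => _; exact.
    case: ifPn; rewrite ?inE ?notin_setE /= => bth.
      rewrite big1 ?mulr1 // => i _; rewrite indicE mem_set //; exact: bth.
    have /existsNP[i nI] := bth.
    by rewrite (bigD1 i) //= indicE memNset // mul0r mulr0.
have int0 S : measurable S -> (\int[torus R d]_(th in S) (u th)%:E = 0)%E.
  rewrite measurable_boxesE; move: S; apply: (@dynkin_induction _ pt boxes).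
  - exact: measurable_boxesE.
  - exact: boxes_setI_closed.
  - apply: int_box; exists (fun=> setT) => [i|]; first by left.
    by apply/seteqP; split.
  - exact: int_box.
  - move=> S mS PS.
    have : (\int[torus R d]_(th in S `|` ~` S) (u th)%:E = 0)%E.
      rewrite setUv; apply: int_box; exists (fun=> setT) => [i|]; first by left.
      by apply/seteqP; split.
    rewrite integral_setU //; last 3 first.
    + exact: measurableC.
    + by apply/measurable_EFinP; exact: measurable_funTS.
    + by apply/disj_setPS => th [].
    by rewrite PS add0e.
  - move=> F mF tF PF; rewrite integral_bigcup //.
      by apply: eseries0 => n _ _; exact: PF.
    by apply: integrableS ui => //; exact: bigcupT_measurable.
have : ae_eq (torus R d) setT (EFin \o u) (cst 0%E).
  apply: integral_ae_eq => // E _ mE; rewrite [LHS]int0 //.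
  by rewrite integral_cst // mul0e.
by apply: filterS => th /(_ I) [].
Qed.

End Boxes.

(** * Square summable and square integrable functions *)

Section Normsq.
Variable R : realType.
Implicit Types x y z : R[i].

Lemma cReD x y : complex.Re (x + y) = complex.Re x + complex.Re y.
Proof. by case: x; case: y. Qed.
Lemma cImD x y : complex.Im (x + y) = complex.Im x + complex.Im y.
Proof. by case: x; case: y. Qed.
Lemma cReN x : complex.Re (- x) = - complex.Re x.
Proof. by case: x. Qed.
Lemma cImN x : complex.Im (- x) = - complex.Im x.
Proof. by case: x. Qed.
Lemma cReM x y : complex.Re (x * y) =
  complex.Re x * complex.Re y - complex.Im x * complex.Im y.
Proof. by case: x; case: y. Qed.
Lemma cImM x y : complex.Im (x * y) =
  complex.Re x * complex.Im y + complex.Im x * complex.Re y.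
Proof. by case: x; case: y. Qed.
Definition cReImE := (cReD, cImD, cReN, cImN, cReM, cImM).

Lemma normsq_ge0 x : 0 <= normsq x.
Proof. by rewrite /normsq addr_ge0 ?sqr_ge0. Qed.

Lemma normsqM x y : normsq (x * y) = normsq x * normsq y.
Proof. by rewrite /normsq !cReImE; ring. Qed.

Lemma normsqN x : normsq (- x) = normsq x.
Proof. by rewrite /normsq !cReImE; ring. Qed.

Lemma normsq0 : normsq (0 : R[i]) = 0.
Proof. by rewrite /normsq /= expr0n /= addr0. Qed.

Lemma normsq_eq0 x : normsq x = 0 -> x = 0.
Proof.
case: x => a b; rewrite /normsq /= => /eqP.
by rewrite paddr_eq0 ?sqr_ge0 // !sqrf_eq0 => /andP[/eqP-> /eqP->].
Qed.

Lemma normsqD_le x y : normsq (x + y) <= 2 * normsq x + 2 * normsq y.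
Proof.
rewrite /normsq !cReImE.
have := sqr_ge0 (complex.Re x - complex.Re y).
have := sqr_ge0 (complex.Im x - complex.Im y).
by move: (complex.Re _) (complex.Im _) (complex.Re _) (complex.Im _) => *; nra.
Qed.

(** This bound replaces the inequality of Cauchy and Schwarz: on a probability
space it makes square integrable functions integrable. *)
Lemma cRe_le x : `|complex.Re x| <= 1 + normsq x.
Proof.
have := sqr_ge0 (complex.Im x); rewrite /normsq.
move: (complex.Re x) (complex.Im x) => a b ?; rewrite ler_norml.
by apply/andP; split; nra.
Qed.

Lemma cIm_le x : `|complex.Im x| <= 1 + normsq x.
Proof.
have := sqr_ge0 (complex.Re x); rewrite /normsq.
move: (complex.Re x) (complex.Im x) => a b ?; rewrite ler_norml.
by apply/andP; split; nra.
Qed.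

End Normsq.

Section Ell2.
Variables (R : realType) (K : choiceType).
Implicit Types (a b : K -> R[i]) (F : {fset K}).

Lemma ell2_ge a F : ((\sum_(k <- F) normsq (a k))%:E <= ell2_sqnorm a)%E.
Proof.
rewrite -sumEFin; apply: esum_ge; exists [set` F]; first by split=> //; exact: finite_fset.
by rewrite fsbig_finite //= set_fsetK.
Qed.

Lemma ell2_le a (M : \bar R) :
  (forall F, (\sum_(k <- F) normsq (a k))%:E <= M)%E -> (ell2_sqnorm a <= M)%E.
Proof.
move=> aM; apply: ge_ereal_sup => _ [A [finA _] <-].
by rewrite fsbig_finite //= sumEFin.
Qed.

Lemma ell2_sqnorm_ge0 a : (0 <= ell2_sqnorm a)%E.
Proof. by apply: esum_ge0 => k _; rewrite lee_fin normsq_ge0. Qed.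

Lemma ell2_fin a : ell2 a -> ell2_sqnorm a \is a fin_num.
Proof. by move=> la; rewrite ge0_fin_numE ?ell2_sqnorm_ge0. Qed.

Lemma ell2_approx a (eps : R) : ell2 a -> 0 < eps -> exists F0,
  (ell2_sqnorm a < (\sum_(k <- F0) normsq (a k) + eps)%:E)%E.
Proof.
move=> la e0.
have [_ [A [finA _] <-]] := ub_ereal_sup_adherent e0 (ell2_fin la).
rewrite fsbig_finite //= sumEFin => lt.
exists (fset_set A); rewrite EFinD.
by rewrite -lteBlDr // .
Qed.

End Ell2.

Section L2.
Variables (R : realType) (disp : measure_display) (T : measurableType disp).
Variable mu : probability T R.
Implicit Types g h : T -> R[i].

Definition cmeasurable g := measurable_fun setT (fun t => complex.Re (g t)) /\
  measurable_fun setT (fun t => complex.Im (g t)).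

Definition sqnorm g : \bar R := (\int[mu]_t (normsq (g t))%:E)%E.

Definition in_L2 g := cmeasurable g /\ (sqnorm g < +oo)%E.

(** The same integral as a real number; it is meaningful only for square
integrable functions, see [rsqnormE]. *)
Definition rsqnorm g : R := \int[mu]_t normsq (g t).

Lemma cmeasurableD g h : cmeasurable g -> cmeasurable h ->
  cmeasurable (fun t => g t + h t).
Proof.
move=> [rg ig] [rh ih]; split.
  by under eq_fun do rewrite cReD; exact: measurable_funD.
by under eq_fun do rewrite cImD; exact: measurable_funD.
Qed.

Lemma cmeasurableM g h : cmeasurable g -> cmeasurable h ->
  cmeasurable (fun t => g t * h t).
Proof.
move=> [rg ig] [rh ih]; split.
  by under eq_fun do rewrite cReM; apply: measurable_funB; exact: measurable_funM.
by under eq_fun do rewrite cImM; apply: measurable_funD; exact: measurable_funM.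
Qed.

Lemma cmeasurable_cst c : cmeasurable (fun=> c).
Proof. by split; exact: measurable_cst. Qed.

Lemma cmeasurableN g : cmeasurable g -> cmeasurable (fun t => - g t).
Proof.
move=> [rg ig]; split.
  by under eq_fun do rewrite cReN; exact: measurable_funN.
by under eq_fun do rewrite cImN; exact: measurable_funN.
Qed.

Lemma cmeasurableB g h : cmeasurable g -> cmeasurable h ->
  cmeasurable (fun t => g t - h t).
Proof. by move=> mg mh; apply: cmeasurableD => //; exact: cmeasurableN. Qed.

Lemma measurable_normsq g : cmeasurable g ->
  measurable_fun setT (fun t => normsq (g t)).
Proof. by move=> [rg ig]; apply: measurable_funD; exact: measurable_funX. Qed.

Lemma measurable_normsqE g : cmeasurable g ->
  measurable_fun setT (fun t => (normsq (g t))%:E).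
Proof. by move=> mg; apply/measurable_EFinP; exact: measurable_normsq. Qed.

Lemma sqnorm_ge0 g : (0 <= sqnorm g)%E.
Proof. by apply: integral_ge0 => t _; rewrite lee_fin normsq_ge0. Qed.

Lemma sqnormD_le g h : cmeasurable g -> cmeasurable h ->
  (sqnorm (fun t => g t + h t)%R <= 2%:E * sqnorm g + 2%:E * sqnorm h)%E.
Proof.
move=> mg mh; have nn g' (t : T) : setT t -> (0 <= (normsq (g' t))%:E)%E.
  by rewrite lee_fin normsq_ge0.
have nn2 g' (t : T) : setT t -> (0 <= 2%:E * (normsq (g' t))%:E)%E.
  by move=> tT; rewrite mule_ge0 // nn.
rewrite /sqnorm -!ge0_integralZl // ?lee_fin //; try exact: nn; try exact: measurable_normsqE.
rewrite -ge0_integralD //; try exact: nn2;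
  try by apply: measurable_funeM; exact: measurable_normsqE.
apply: ge0_le_integral => //; try exact: nn.
- exact/measurable_normsqE/cmeasurableD.
- by apply: emeasurable_funD; apply: measurable_funeM; exact: measurable_normsqE.
- by move=> t _; rewrite -!EFinM -EFinD lee_fin normsqD_le.
Qed.

Lemma sqnormZ c g : cmeasurable g ->
  sqnorm (fun t => c * g t) = ((normsq c)%:E * sqnorm g)%E.
Proof.
move=> mg; rewrite /sqnorm -ge0_integralZl //.
- by apply: eq_integral => t _; rewrite normsqM EFinM.
- exact: measurable_normsqE.
- by move=> t _; rewrite lee_fin normsq_ge0.
- by rewrite lee_fin normsq_ge0.
Qed.

Lemma sqnormN g : sqnorm (fun t => - g t) = sqnorm g.
Proof. by apply: eq_integral => t _; rewrite normsqN. Qed.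

Lemma sqnormB_le g h : cmeasurable g -> cmeasurable h ->
  (sqnorm (fun t => g t - h t)%R <= 2%:E * sqnorm g + 2%:E * sqnorm h)%E.
Proof.
move=> mg mh; rewrite -(sqnormN h); apply: sqnormD_le => //.
exact: cmeasurableN.
Qed.

Lemma in_L2D g h : in_L2 g -> in_L2 h -> in_L2 (fun t => g t + h t).
Proof.
move=> [mg fg] [mh fh]; split; first exact: cmeasurableD.
apply: le_lt_trans (sqnormD_le mg mh) _.
by rewrite lte_add_pinfty // lte_mul_pinfty // ?lee_fin // sqnorm_ge0.
Qed.

Lemma in_L2Z c g : in_L2 g -> in_L2 (fun t => c * g t).
Proof.
move=> [mg fg]; split; first by apply: cmeasurableM => //; exact: cmeasurable_cst.
by rewrite sqnormZ // lte_mul_pinfty // ?lee_fin ?normsq_ge0.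
Qed.

Lemma in_L2N g : in_L2 g -> in_L2 (fun t => - g t).
Proof. by move=> [mg fg]; split; [exact: cmeasurableN|rewrite sqnormN]. Qed.

Lemma in_L2B g h : in_L2 g -> in_L2 h -> in_L2 (fun t => g t - h t).
Proof. by move=> Lg Lh; apply: in_L2D => //; exact: in_L2N. Qed.

Lemma in_L2_0 : in_L2 (fun=> 0).
Proof.
split; first exact: cmeasurable_cst.
by rewrite /sqnorm; under eq_integral do rewrite normsq0; rewrite integral0.
Qed.

Lemma in_L2_sum (I : Type) (s : seq I) (f : I -> T -> R[i]) :
  (forall i, in_L2 (f i)) -> in_L2 (fun t => \sum_(i <- s) f i t).
Proof.
move=> mf; elim: s => [|i s IH].
  by under eq_fun do rewrite big_nil; exact: in_L2_0.
by under eq_fun do rewrite big_cons; exact: in_L2D.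
Qed.

Lemma rsqnormE g : in_L2 g -> sqnorm g = (rsqnorm g)%:E.
Proof.
by move=> [_ fg]; rewrite /rsqnorm /Rintegral fineK // ge0_fin_numE ?sqnorm_ge0.
Qed.

Lemma in_L2_integrable_normsq g : in_L2 g ->
  mu.-integrable setT (fun t => (normsq (g t))%:E).
Proof.
move=> [mg fg]; apply/integrableP; split; first exact: measurable_normsqE.
by under eq_integral => t _ do rewrite gee0_abs ?lee_fin ?normsq_ge0 //.
Qed.

Lemma in_L2_integrable g : in_L2 g ->
  mu.-integrable setT (fun t => (complex.Re (g t))%:E) /\
  mu.-integrable setT (fun t => (complex.Im (g t))%:E).
Proof.
move=> Lg; have [[rg ig] _] := Lg.
have i1 : mu.-integrable setT (fun t => (1 + normsq (g t))%:E).
  under eq_fun do rewrite EFinD.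
  apply: integrableD => //; first exact: finite_measure_integrable_cst.
  exact: in_L2_integrable_normsq.
split; apply: le_integrable i1 => //; try by apply/measurable_EFinP.
  move=> t _; rewrite lee_fin (le_trans (cRe_le _)) // ler_norm //.
move=> t _; rewrite lee_fin (le_trans (cIm_le _)) // ler_norm //.
Qed.

Lemma ae_eq_sqnorm g h : cmeasurable g -> cmeasurable h ->
  {ae mu, forall t, g t = h t} -> sqnorm g = sqnorm h.
Proof.
move=> mg mh gh; apply: ae_eq_integral => //; try exact: measurable_normsqE.
by apply: filterS gh => t -> _.
Qed.

End L2.

(** * Expansions in an orthonormal system of unimodular functions *)

Section Orthonormal.
Variables (R : realType) (disp : measure_display) (T : measurableType disp).
Variable mu : probability T R.
Variables (K : choiceType) (e : K -> T -> R[i]).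
Implicit Types (g h : T -> R[i]) (a b : K -> R[i]) (s : seq K).

Hypothesis me : forall k, cmeasurable (e k).
Hypothesis e_unimodular : forall k t, normsq (e k t) = 1.

Lemma Rintegral_probability_cst (c : R) : \int[mu]_(_ in setT) c = c.
Proof.
by rewrite /Rintegral integral_cst //= probability_setT mule1.
Qed.

(** The real and imaginary parts of the product of [g] with the conjugate of [h].
Keeping them apart reduces the complex integral to two real ones. *)
Definition re_prod g h t := complex.Re (g t) * complex.Re (h t) +
  complex.Im (g t) * complex.Im (h t).
Definition im_prod g h t := complex.Im (g t) * complex.Re (h t) -
  complex.Re (g t) * complex.Im (h t).

Definition coef g k : R[i] :=
  Complex (\int[mu]_t re_prod g (e k) t) (\int[mu]_t im_prod g (e k) t).

Hypothesis e_orthonormal : forall j k, coef (e j) k = (j == k)%:R.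

Lemma e_in_L2 k : in_L2 mu (e k).
Proof.
split=> //; rewrite /sqnorm; under eq_integral do rewrite e_unimodular.
by rewrite integral_cst //= probability_setT mule1 ltry.
Qed.

Lemma e_Re_le k t : `|complex.Re (e k t)| <= 1.
Proof.
have := e_unimodular k t; rewrite /normsq ler_norml.
move: (complex.Re _) (complex.Im _) => x y H; have := sqr_ge0 y => ?.
by apply/andP; split; nra.
Qed.

Lemma e_Im_le k t : `|complex.Im (e k t)| <= 1.
Proof.
have := e_unimodular k t; rewrite /normsq ler_norml.
move: (complex.Re _) (complex.Im _) => x y H; have := sqr_ge0 x => ?.
by apply/andP; split; nra.
Qed.

Lemma integrable_re_prod g k : in_L2 mu g ->
  mu.-integrable setT (EFin \o re_prod g (e k)).
Proof.
move=> /in_L2_integrable[ig1 ig2].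
have := integrableD measurableT
  (integrable_mul_bounded ig1 (me k).1 (e_Re_le k))
  (integrable_mul_bounded ig2 (me k).2 (e_Im_le k)).
exact.
Qed.

Lemma integrable_im_prod g k : in_L2 mu g ->
  mu.-integrable setT (EFin \o im_prod g (e k)).
Proof.
move=> /in_L2_integrable[ig1 ig2].
have := integrableB measurableT
  (integrable_mul_bounded ig2 (me k).1 (e_Re_le k))
  (integrable_mul_bounded ig1 (me k).2 (e_Im_le k)).
exact.
Qed.

Lemma coef_lin g h (c : R[i]) k : in_L2 mu g -> in_L2 mu h ->
  coef (fun t => g t - c * h t) k = coef g k - c * coef h k.
Proof.
move=> Lg Lh; case: c => c d.
have [rg ig] := (integrable_re_prod k Lg, integrable_im_prod k Lg).
have [rh ih] := (integrable_re_prod k Lh, integrable_im_prod k Lh).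
have zrh x := integrableZl measurableT x rh.
have zih x := integrableZl measurableT x ih.
rewrite /coef; congr Complex => /=.
  transitivity (\int[mu]_t ((re_prod g (e k) t - c * re_prod h (e k) t) +
      d * im_prod h (e k) t)).
    by apply: eq_Rintegral => t _; rewrite /re_prod /im_prod !cReImE /=; ring.
  rewrite RintegralD //; last 2 first.
  - exact: (integrableB measurableT rg (zrh c)).
  - exact: zih.
  rewrite RintegralB //; last exact: zrh.
  by rewrite !RintegralZl //=; ring.
transitivity (\int[mu]_t ((im_prod g (e k) t - c * im_prod h (e k) t) -
    d * re_prod h (e k) t)).
  by apply: eq_Rintegral => t _; rewrite /re_prod /im_prod !cReImE /=; ring.
rewrite RintegralB //; last 2 first.
- exact: (integrableB measurableT ig (zih c)).
- exact: zrh.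
rewrite RintegralB //; last exact: zih.
by rewrite !RintegralZl //=; ring.
Qed.

(** Completing the square.  Since the basis functions have modulus 1, the
quadratic term is constant. *)
Lemma rsqnorm_sub g (c : R[i]) k : in_L2 mu g ->
  rsqnorm mu (fun t => g t - c * e k t) =
    rsqnorm mu g + (normsq (c - coef g k) - normsq (coef g k)).
Proof.
move=> Lg; case: c => c d.
have [rg ig] := (integrable_re_prod k Lg, integrable_im_prod k Lg).
have ng := in_L2_integrable_normsq Lg.
have zrg x := integrableZl measurableT x rg.
have zig x := integrableZl measurableT x ig.
have icst x : mu.-integrable setT (EFin \o (fun=> x)).
  exact: finite_measure_integrable_cst.
transitivity (\int[mu]_t ((normsq (g t) - (2 * c) * re_prod g (e k) t) -
    (2 * d) * im_prod g (e k) t + (c ^+ 2 + d ^+ 2))).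
  apply: eq_Rintegral => t _.
  have -> : c ^+ 2 + d ^+ 2 = (c ^+ 2 + d ^+ 2) * normsq (e k t).
    by rewrite e_unimodular mulr1.
  by rewrite /normsq /re_prod /im_prod !cReImE /=; ring.
have i1 : mu.-integrable setT (EFin \o (fun t => normsq (g t) - (2 * c) * re_prod g (e k) t)).
  exact: (integrableB measurableT ng (zrg (2 * c))).
have i2 : mu.-integrable setT (EFin \o (fun t => normsq (g t) -
    (2 * c) * re_prod g (e k) t - (2 * d) * im_prod g (e k) t)).
  exact: (integrableB measurableT i1 (zig (2 * d))).
rewrite RintegralD // RintegralB //; last exact: zig.
rewrite RintegralB //; last exact: zrg.
rewrite !RintegralZl // Rintegral_probability_cst /rsqnorm /coef.
by rewrite /normsq !cReImE /=; ring.
Qed.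

Definition psum a s t := \sum_(k <- s) e k t * a k.

Lemma psum_in_L2 a s : in_L2 mu (psum a s).
Proof.
apply: in_L2_sum => k; under eq_fun do rewrite mulrC.
exact: in_L2Z (e_in_L2 k).
Qed.

Lemma psum_cmeasurable a s : cmeasurable (psum a s).
Proof. by have [] := psum_in_L2 a s. Qed.

Lemma rsqnorm_psum g a s : in_L2 mu g -> uniq s ->
  rsqnorm mu (fun t => g t - psum a s t) = rsqnorm mu g +
    \sum_(k <- s) (normsq (a k - coef g k) - normsq (coef g k)).
Proof.
elim: s g => [|k s IH] g Lg /=.
  rewrite big_nil addr0 => _; apply: eq_Rintegral => t _.
  by rewrite /psum big_nil subr0.
move=> /andP[ks us]; rewrite big_cons addrA -rsqnorm_sub //.
have Le := e_in_L2 k.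
transitivity (rsqnorm mu (fun t => (g t - a k * e k t) - psum a s t)).
  apply: eq_Rintegral => t _.
  by rewrite /psum big_cons opprD addrA (mulrC (e k t)).
rewrite IH //; last exact: in_L2B Lg (in_L2Z _ Le).
congr (_ + _); apply: eq_big_seq => j js.
rewrite coef_lin // e_orthonormal; case: eqP => [kj|_].
  by rewrite kj js in ks.
by rewrite mulr0 subr0.
Qed.

Lemma coef_cst0 k : coef (fun=> 0) k = 0.
Proof.
rewrite /coef; under eq_Rintegral do rewrite /re_prod /= !mul0r addr0.
under [X in Complex _ X]eq_Rintegral do rewrite /im_prod /= !mul0r subr0.
by rewrite Rintegral_probability_cst.
Qed.

Lemma sqnorm_psum a s : uniq s ->
  sqnorm mu (psum a s) = (\sum_(k <- s) normsq (a k))%:E.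
Proof.
move=> us; rewrite rsqnormE; last exact: psum_in_L2.
have := rsqnorm_psum a (in_L2_0 mu) us.
rewrite (_ : rsqnorm mu (fun t => 0 - psum a s t) = rsqnorm mu (psum a s)); last first.
  by apply: eq_Rintegral => t _; rewrite sub0r normsqN.
move=> ->; rewrite (_ : rsqnorm mu (fun=> 0) = 0) ?add0r; last first.
  by rewrite /rsqnorm normsq0 Rintegral_probability_cst.
congr EFin; apply: eq_bigr => k _.
by rewrite coef_cst0 subr0 normsq0 subr0.
Qed.

Lemma rsqnorm_ge0 g : 0 <= rsqnorm mu g.
Proof. by apply: Rintegral_ge0 => t _; exact: normsq_ge0. Qed.

Lemma bessel g (F : {fset K}) : in_L2 mu g ->
  \sum_(k <- F) normsq (coef g k) <= rsqnorm mu g.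
Proof.
move=> Lg; have := rsqnorm_ge0 (fun t => g t - psum (coef g) F t).
rewrite rsqnorm_psum // sumrB [X in X - _]big1 ?sub0r ?subr_ge0 //.
by move=> k _; rewrite subrr normsq0.
Qed.

Lemma coef_ell2 g : in_L2 mu g -> ell2 (coef g).
Proof.
move=> Lg; apply: le_lt_trans (ltry (rsqnorm mu g)).
by apply: ell2_le => F; rewrite lee_fin; exact: bessel.
Qed.

(** This is the convergence that defines the Gelfand transformation, at one
vertex: unconditional convergence in L2 along finite index sets. *)
Definition fourier a g := [/\ ell2 a, in_L2 mu g &
  forall eps : R, 0 < eps -> exists F0 : {fset K}, forall F : {fset K},
    (F0 `<=` F)%fset -> (sqnorm mu (fun t => (g t - psum a F t)%R) < eps%:E)%E].

(** By the norm formula and Bessel, the distance from [g] to a partial sum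
containing the index [k] is at least that of [a k] from the coefficient. *)
Lemma fourier_coef a g : fourier a g -> coef g =1 a.
Proof.
move=> [la Lg ag] k; apply/esym/eqP; rewrite -subr_eq0; apply/eqP/normsq_eq0.
apply/eqP; rewrite eq_le normsq_ge0 andbT; apply/ler_addgt0Pl => eps e0; rewrite addr0.
have [F0 /(_ (k |` F0)%fset)] := ag _ e0.
rewrite fsubsetU1 => /(_ isT); set F := (k |` F0)%fset.
have Ls : in_L2 mu (fun t => g t - psum a F t) by apply: in_L2B => //; exact: psum_in_L2.
rewrite rsqnormE // lte_fin rsqnorm_psum // sumrB.
have B := bessel F Lg.
have : normsq (a k - coef g k) <= \sum_(j <- F) normsq (a j - coef g j).
  rewrite (big_fsetD1 k) ?fset1U1 //= lerDl; apply: sumr_ge0 => j _.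
  exact: normsq_ge0.
by move=> *; lra.
Qed.

(** Once the coefficients are known, the distance from [g] to a partial sum is
the norm of [g] minus the partial sum of the norm of [a]. *)
Lemma parseval a g : fourier a g -> sqnorm mu g = ell2_sqnorm a.
Proof.
move=> fag; have ga := fourier_coef fag; have [la Lg ag] := fag.
have sumE (F : {fset K}) : \sum_(k <- F) normsq (coef g k) = \sum_(k <- F) normsq (a k).
  by apply: eq_bigr => k _; rewrite ga.
apply/eqP; rewrite eq_le; apply/andP; split; last first.
  by apply: ell2_le => F; rewrite rsqnormE // lee_fin -sumE bessel.
apply/lee_addgt0Pr => eps e0.
have [F0 /(_ F0 (fsubset_refl _))] := ag _ e0.
have Ls : in_L2 mu (fun t => g t - psum a F0 t) by apply: in_L2B => //; exact: psum_in_L2.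
rewrite (rsqnormE Ls) lte_fin rsqnorm_psum // sumrB [X in X - _]big1; last first.
  by move=> k _; rewrite ga subrr normsq0.
rewrite sub0r sumE => lt; rewrite rsqnormE //.
apply: (@le_trans _ _ ((\sum_(k <- F0) normsq (a k))%:E + eps%:E)%E).
  by rewrite -EFinD lee_fin; lra.
by apply: leeD => //; exact: ell2_ge.
Qed.

Lemma fourier_ae a g h : fourier a g -> cmeasurable h ->
  {ae mu, forall t, h t = g t} -> fourier a h.
Proof.
move=> [la [mg fg] ag] mh hg; split=> //.
  by split=> //; rewrite (ae_eq_sqnorm mh mg).
move=> eps e0; have [F0 H] := ag _ e0; exists F0 => F FF.
apply: le_lt_trans (H F FF); rewrite (@ae_eq_sqnorm _ _ _ _ _ (fun t => g t - psum a F t)) //.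
- by apply: cmeasurableB => //; exact: psum_cmeasurable.
- by apply: cmeasurableB => //; exact: psum_cmeasurable.
- by apply: filterS hg => t ->.
Qed.

End Orthonormal.

(** * Completeness of L2 *)

Section Complete.
Variables (R : realType) (disp : measure_display) (T : measurableType disp).
Variable mu : probability T R.

Lemma is_cvg_geometric_steps (u : nat -> R) C :
  (forall n, `|u n.+1 - u n| <= C * 2^-1 ^+ n) -> cvgn u.
Proof.
move=> uC; have C0 : 0 <= C.
  by have := le_trans (normr_ge0 _) (uC 0%N); rewrite expr0 mulr1.
have half : `|2^-1 : R| < 1 by rewrite ger0_norm; lra.
have : cvgn (series (telescope u)).
  apply: normed_cvg; apply: (@series_le_cvg _ _ (geometric C 2^-1)) => [n|n|n|] //=.
  - by rewrite mulr_ge0 // exprn_ge0 // invr_ge0.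
  - exact: uC.
  - exact: is_cvg_geometric_series.
move=> /cvg_ex[l ul]; apply/cvg_ex; exists (u 0%N + l).
have : u 0%N + series (telescope u) n @[n --> \oo] --> u 0%N + l.
  by apply: cvgD => //; exact: cvg_cst.
rewrite (_ : (fun n => u 0%N + series (telescope u) n) = u) //.
by apply/funext => n; rewrite -eq_sum_telescope.
Qed.

Lemma limn_einf_le (u : nat -> \bar R) c : (forall n, u n <= c)%E -> (limn_einf u <= c)%E.
Proof.
move=> uc; rewrite limn_einf_lim; apply: lime_le; first exact: is_cvg_einfs.
apply: nearW => n; apply: le_trans (uc n); apply: ereal_inf_lbound.
by exists n => //=.
Qed.

(** The weight turns a bound into geometric decay: from [(2^n x)^2 <= M] follows
[x <= (1 + |M|) / 2^n], without taking square roots. *)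
Lemma normsq_steps_cvg (z : nat -> R[i]) (M : R) :
  (forall n, 4 ^+ n * normsq (z n.+1 - z n) <= M) ->
  cvgn (fun n => complex.Re (z n)) /\ cvgn (fun n => complex.Im (z n)).
Proof.
move=> zM; pose C := 1 + `|M|.
have C1 : 1 <= C by rewrite lerDl.
have MC : M <= C by rewrite (le_trans (ler_norm M)) // lerDr.
have step n x : 0 <= x -> 4 ^+ n * x ^+ 2 <= M -> x <= C * 2^-1 ^+ n.
  move=> x0 xM; set y := 2 ^+ n * x.
  have y0 : 0 <= y by rewrite mulr_ge0 // exprn_ge0.
  have yM : y ^+ 2 <= M.
    by rewrite /y exprMn -exprM mulnC exprM (_ : 2 ^+ 2 = 4) //; ring.
  have yC : y <= C by nra.
  rewrite exprVn ler_pdivlMr ?exprn_gt0 //; rewrite /y in yC; lra.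
split; apply: (@is_cvg_geometric_steps _ C) => n; apply: step => //;
  apply: le_trans (zM n); rewrite ler_wpM2l ?exprn_ge0 // real_normK ?num_real //.
  by rewrite /normsq !cReImE lerDl sqr_ge0.
by rewrite /normsq !cReImE lerDr sqr_ge0.
Qed.

(** Riesz-Fischer.  The weighted sum of the squared steps has a finite integral,
so it is finite almost everywhere, which forces convergence there.  The upper
limit is used to define the limit function because it is measurable
everywhere, and Fatou passes the Cauchy estimate to the limit. *)
Lemma L2_fast_cauchy_cvg (S : nat -> T -> R[i]) :
  (forall n, in_L2 mu (S n)) ->
  (forall n m, (sqnorm mu (fun t => (S (m + n)%N t - S n t)%R) <= (16^-1 ^+ n)%:E)%E) ->
  exists2 g, in_L2 mu g &
    forall n, (sqnorm mu (fun t => (g t - S n t)%R) <= (16^-1 ^+ n)%:E)%E.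
Proof.
move=> LS cS; have mS n : cmeasurable (S n) by case: (LS n).
pose h n t := S n.+1 t - S n t.
have mh n : cmeasurable (h n) by apply: cmeasurableB.
pose w t := (\sum_(0 <= n <oo) (4 ^+ n * normsq (h n t))%:E)%E.
have w0 n t : (0 <= (4 ^+ n * normsq (h n t))%:E)%E.
  by rewrite lee_fin mulr_ge0 ?exprn_ge0 ?normsq_ge0.
have mw n : measurable_fun setT (fun t => (4 ^+ n * normsq (h n t))%:E).
  by apply/measurable_EFinP; apply: measurable_funM => //; exact: measurable_normsq.
(* 4^n * 16^-n = 4^-n is summable. *)
have wfin : {ae mu, forall t, (w t < +oo)%E}.
  have iw : mu.-integrable setT w.
    apply/integrableP; split.
      exact: ge0_emeasurable_sum.
    under eq_integral => t _ do rewrite gee0_abs ?nneseries_ge0 //.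
    rewrite integral_nneseries //.
    apply: (@le_lt_trans _ _ (\sum_(0 <= n <oo) (4^-1 ^+ n : R)%:E)%E).
      apply: lee_nneseries => [n _ _|n _]; first exact: integral_ge0.
      under eq_integral => t _ do rewrite EFinM.
      rewrite ge0_integralZl //; last 2 first.
      - exact: measurable_normsqE.
      - by move=> t _; rewrite lee_fin normsq_ge0.
      apply: (@le_trans _ _ ((4 ^+ n)%:E * (16^-1 ^+ n)%:E)%E).
        by rewrite lee_pmul2l ?lte_fin ?exprn_gt0 //; exact: (cS n 1%N).
      by rewrite -EFinM -exprMn lee_fin (_ : 4 * 16^-1 = 4^-1) //; field.
    have q4 : `|4^-1 : R| < 1 by rewrite ger0_norm; lra.
    have cg := @cvg_geometric_series R 1 _ q4.
    rewrite (_ : (fun k => _) = EFin \o (fun k => series (geometric (1 : R) 4^-1) k)).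
      by rewrite (cvg_lim _ (cvg_EFin _ cg)) ?ltry //; exact: nearW.
    apply/funext => k /=; rewrite -sumEFin /=; apply: eq_bigr => i _.
    by rewrite mul1r.
  apply: filterS (integrable_ae measurableT iw) => t /(_ I).
  by rewrite fin_numE => /andP[_]; rewrite -ltey.
pose g t := Complex (fine (limn_esup (fun n => (complex.Re (S n t))%:E)))
  (fine (limn_esup (fun n => (complex.Im (S n t))%:E))).
have mg : cmeasurable g.
  split; rewrite /g /=; apply: measurableT_comp => //;
  by apply: measurable_fun_limn_esup => n; apply/measurable_EFinP; case: (mS n).
have cg : {ae mu, forall t, complex.Re (S n t) @[n --> \oo] --> complex.Re (g t) /\
    complex.Im (S n t) @[n --> \oo] --> complex.Im (g t)}.
  apply: filterS wfin => t wt.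
  have wE : w t \is a fin_num by rewrite ge0_fin_numE // nneseries_ge0.
  have [|/cvg_ex[l1 c1] /cvg_ex[l2 c2]] := @normsq_steps_cvg (S ^~ t) (fine (w t)).
    move=> n; rewrite -lee_fin fineK //.
    rewrite /w (@nneseriesD1 _ _ n) //=.
    by rewrite leeDl // nneseries_ge0.
  have lE (u : nat -> R) l : u n @[n --> \oo] --> l ->
      fine (limn_esup (fun n => (u n)%:E)) = l.
    move=> ul; have cu : (u n)%:E @[n --> \oo] --> l%:E.
      by apply: cvg_EFin => //; exact: nearW.
    by have [_ ->] := cvg_limn_einf_sup cu.
  by rewrite /g /= (lE _ _ c1) (lE _ _ c2).
have gS n : (sqnorm mu (fun t => (g t - S n t)%R) <= (16^-1 ^+ n)%:E)%E.
  pose f m t := (normsq (S (m + n)%N t - S n t))%:E.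
  have mf m : measurable_fun setT (f m).
    by apply: measurable_normsqE; exact: cmeasurableB.
  apply: (@le_trans _ _ (\int[mu]_t (limn_einf (f ^~ t)))%E); last first.
    have nn m t : setT t -> (0 <= f m t)%E by rewrite lee_fin normsq_ge0.
    apply: le_trans (fatou mu measurableT mf nn) _.
    by apply: limn_einf_le => m; exact: cS.
  rewrite le_eqVlt; apply/orP; left; apply/eqP; apply: ae_eq_integral => //.
  - by apply: measurable_normsqE; exact: cmeasurableB.
  - rewrite /limn_einf /limf_einf; apply: measurableT_comp => //.
    apply: measurable_fun_limn_esup => m; exact: measurableT_comp.
  apply: filterS cg => t [cr ci] _.
  have cr' : complex.Re (S (m + n)%N t) @[m --> \oo] --> complex.Re (g t).
    by rewrite (cvg_shiftn n (fun m => complex.Re (S m t))).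
  have ci' : complex.Im (S (m + n)%N t) @[m --> \oo] --> complex.Im (g t).
    by rewrite (cvg_shiftn n (fun m => complex.Im (S m t))).
  have nE z : normsq (z - S n t) =
      (complex.Re z - complex.Re (S n t)) * (complex.Re z - complex.Re (S n t)) +
      (complex.Im z - complex.Im (S n t)) * (complex.Im z - complex.Im (S n t)).
    by rewrite /normsq !cReImE !expr2.
  have cf : f m t @[m --> \oo] --> (normsq (g t - S n t))%:E.
    apply: cvg_EFin; first exact: nearW.
    rewrite /f /comp /= nE; under eq_fun do rewrite nE.
    by apply: cvgD; apply: cvgM; apply: cvgB => //; exact: cvg_cst.
  by have [-> _] := cvg_limn_einf_sup cf.
exists g => //.
have L0 : in_L2 mu (fun t => g t - S 0%N t).
  by split; [exact: cmeasurableB|exact: le_lt_trans (gS 0%N) (ltry _)].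
rewrite (_ : g = (fun t => (g t - S 0%N t) + S 0%N t)); first exact: in_L2D.
by apply/funext => t; rewrite subrK.
Qed.

End Complete.

(** * Orthonormal bases: the isometry between l2 and L2 *)

Section FourierIso.
Variables (R : realType) (disp : measure_display) (T : measurableType disp).
Variable mu : probability T R.
Variables (K : choiceType) (e : K -> T -> R[i]).
Implicit Types (g h : T -> R[i]) (a b : K -> R[i]).

Hypothesis me : forall k, cmeasurable (e k).
Hypothesis e_unimodular : forall k t, normsq (e k t) = 1.
Hypothesis e_orthonormal : forall j k, coef mu e (e j) k = (j == k)%:R.
Hypothesis e_complete : forall g, in_L2 mu g -> (forall k, coef mu e g k = 0) ->
  {ae mu, forall t, g t = 0}.

Lemma big_fset_sub (V : zmodType) (E F : {fset K}) (f : K -> V) :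
  (E `<=` F)%fset ->
  \sum_(k <- F) f k = \sum_(k <- E) f k + \sum_(k <- (F `\` E)%fset) f k.
Proof.
move=> EF; rewrite (big_fsetID _ (mem E)) /=; congr (_ + _); apply: eq_fbigl => k.
  by rewrite !inE /= andbC; case: (boolP (k \in E)) => // kE; rewrite (fsubsetP EF).
by rewrite !inE /= andbC.
Qed.

Lemma psum_fset_sub a (E F : {fset K}) t : (E `<=` F)%fset ->
  psum e a F t - psum e a E t = psum e a (F `\` E)%fset t.
Proof. by move=> EF; rewrite /psum (big_fset_sub _ EF) addrC addKr. Qed.

(** A finite set carrying all but [eps] of the norm of [a] leaves at most [eps]
to any finite set disjoint from it. *)
Lemma ell2_tail a (eps : R) : ell2 a -> 0 < eps -> exists F0 : {fset K},
  forall E F : {fset K}, (F0 `<=` E)%fset -> (E `<=` F)%fset ->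
  (sqnorm mu (fun t => (psum e a F t - psum e a E t)%R) <= eps%:E)%E.
Proof.
move=> la e0; have [F0 H0] := ell2_approx la e0; exists F0 => E F F0E EF.
under eq_fun do rewrite psum_fset_sub //.
rewrite sqnorm_psum // lee_fin.
have := lt_le_trans (le_lt_trans (ell2_ge a F) H0) (lexx _).
rewrite lte_fin (big_fset_sub _ EF) (big_fset_sub _ F0E) -addrA ltrD2l.
have : 0 <= \sum_(k <- (E `\` F0)%fset) normsq (a k).
  by apply: sumr_ge0 => k _; exact: normsq_ge0.
by lra.
Qed.

(** The partial sums over an increasing sequence of finite sets with rapidly
decreasing tails form a fast Cauchy sequence; the tails also control every
larger finite set. *)
Lemma fourier_exists a : ell2 a -> exists g, fourier mu e a g.
Proof.
move=> la.
have /choice [F0 HF0] : forall n : nat, exists F0 : {fset K},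
    forall E F : {fset K}, (F0 `<=` E)%fset -> (E `<=` F)%fset ->
    (sqnorm mu (fun t => (psum e a F t - psum e a E t)%R) <= (16^-1 ^+ n)%:E)%E.
  by move=> n; apply: ell2_tail => //; rewrite exprn_gt0.
pose E n := iteri n (fun m A => A `|` F0 m.+1)%fset (F0 0%N).
have F0E n : (F0 n `<=` E n)%fset by case: n => [|n] //=; exact: fsubsetUr.
have EE n m : (E n `<=` E (m + n)%N)%fset.
  by elim: m => // m IH; rewrite addSn; apply: fsubset_trans IH (fsubsetUl _ _).
have [g Lg gE] : exists2 g, in_L2 mu g & forall n,
    (sqnorm mu (fun t => (g t - psum e a (E n) t)%R) <= (16^-1 ^+ n)%:E)%E.
  apply: L2_fast_cauchy_cvg => [n|n m]; first exact: psum_in_L2.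
  exact: HF0.
exists g; split=> // eps eps0.
have [n n_eps] : exists n : nat, 4 * 16^-1 ^+ n < eps.
  have q1 : `|16^-1 : R| < 1 by rewrite ger0_norm; lra.
  have /cvgr0_norm_lt /(_ _ eps0) := @cvg_geometric R 4 _ q1.
  by case=> n _ /(_ n (leqnn n)) /=; rewrite ger0_norm ?mulr_ge0 ?exprn_ge0 //; exists n.
exists (E n) => F EF.
have mP s : cmeasurable (psum e a s) by exact: psum_cmeasurable.
rewrite (_ : (fun t => _) = (fun t => (g t - psum e a (E n) t) -
    (psum e a F t - psum e a (E n) t))); last by apply/funext => t; ring.
apply: le_lt_trans (sqnormB_le _ _ _) _; try by apply: cmeasurableB => //; case: Lg.
apply: (@le_lt_trans _ _ (2%:E * (16^-1 ^+ n)%:E + 2%:E * (16^-1 ^+ n)%:E)%E).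
  apply: leeD; rewrite lee_pmul2l ?lte_fin //; exact: HF0.
by rewrite -!EFinM -EFinD lte_fin; lra.
Qed.

Lemma fourier_unique a g h : fourier mu e a g -> fourier mu e a h ->
  {ae mu, forall t, g t = h t}.
Proof.
move=> fg fh; have [_ Lg _] := fg; have [_ Lh _] := fh.
have : {ae mu, forall t, g t - 1 * h t = 0}.
  apply: e_complete => [|k]; first by apply: in_L2B => //; exact: in_L2Z.
  rewrite coef_lin // (fourier_coef me e_unimodular e_orthonormal fg).
  by rewrite (fourier_coef me e_unimodular e_orthonormal fh) mul1r subrr.
by apply: filterS => t; rewrite mul1r => /eqP; rewrite subr_eq0 => /eqP.
Qed.

(** The coefficients of [g] are square summable by Bessel, so their series has
some sum; [g] and that sum have the same coefficients, and completeness
identifies them. *)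
Lemma fourier_surj g : in_L2 mu g -> fourier mu e (coef mu e g) g.
Proof.
move=> Lg; have lg := coef_ell2 me e_unimodular e_orthonormal Lg.
have [h fh] := fourier_exists lg; have [_ Lh _] := fh.
have : {ae mu, forall t, g t - 1 * h t = 0}.
  apply: e_complete => [|k]; first by apply: in_L2B => //; exact: in_L2Z.
  rewrite coef_lin // (fourier_coef me e_unimodular e_orthonormal fh).
  by rewrite mul1r subrr.
move=> gh; apply: fourier_ae fh _ _ => //; first by case: Lg.
by apply: filterS gh => t; rewrite mul1r => /eqP; rewrite subr_eq0 => /eqP.
Qed.

Lemma ell2_lin (c : R[i]) a b : ell2 a -> ell2 b -> ell2 (fun k => c * a k + b k).
Proof.
move=> la lb.
apply: (@le_lt_trans _ _ (2%:E * (normsq c)%:E * ell2_sqnorm a + 2%:E * ell2_sqnorm b)%E).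
  apply: ell2_le => F.
  apply: (@le_trans _ _ (2%:E * (normsq c)%:E * (\sum_(k <- F) normsq (a k))%:E +
      2%:E * (\sum_(k <- F) normsq (b k))%:E)%E).
    rewrite -!EFinM -EFinD lee_fin !mulr_sumr -big_split /=; apply: ler_sum => k _.
    by rewrite -mulrA -normsqM; exact: normsqD_le.
  by apply: leeD; apply: lee_wpmul2l; rewrite ?ell2_ge // -?EFinM lee_fin ?mulr_ge0 ?normsq_ge0.
rewrite -EFinM -[ell2_sqnorm a]fineK ?ell2_fin // -[ell2_sqnorm b]fineK ?ell2_fin //.
by rewrite -!EFinM -EFinD ltry.
Qed.

Lemma fourier_lin (c : R[i]) a g b h : fourier mu e a g -> fourier mu e b h ->
  fourier mu e (fun k => c * a k + b k) (fun t => c * g t + h t).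
Proof.
move=> [la Lg fg] [lb Lh fh]; split.
- exact: ell2_lin.
- by apply: in_L2D => //; exact: in_L2Z.
move=> eps e0.
pose M := 1 + normsq c; have M0 : 0 < M by rewrite ltr_pwDl ?normsq_ge0.
have [F1 H1] := fg (eps / (4 * M)) (divr_gt0 e0 (mulr_gt0 (ltr0n _ 4) M0)).
have [F2 H2] := fh (eps / 4) (divr_gt0 e0 (ltr0n _ 4)).
exists (F1 `|` F2)%fset => F; rewrite fsubUset => /andP[F1F F2F].
have mP a' s : cmeasurable (psum e a' s) by exact: psum_cmeasurable.
have [mg mh] : cmeasurable g /\ cmeasurable h by split; [case: Lg|case: Lh].
rewrite (_ : (fun t => _) = (fun t => c * (g t - psum e a F t) +
    (h t - psum e b F t))); last first.
  apply/funext => t; rewrite (_ : psum _ _ _ _ = c * psum e a F t + psum e b F t).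
    by ring.
  by rewrite /psum mulr_sumr -big_split; apply: eq_bigr => k _ /=; ring.
apply: le_lt_trans (sqnormD_le _ _ _) _.
- by apply: cmeasurableM; [exact: cmeasurable_cst|exact: cmeasurableB].
- exact: cmeasurableB.
rewrite sqnormZ; last exact: cmeasurableB.
have La : in_L2 mu (fun t => g t - psum e a F t) by apply: in_L2B => //; exact: psum_in_L2.
have Lb : in_L2 mu (fun t => h t - psum e b F t) by apply: in_L2B => //; exact: psum_in_L2.
have := H1 F F1F; have := H2 F F2F.
rewrite (rsqnormE La) (rsqnormE Lb) -!EFinM -EFinD !lte_fin.
set x := rsqnorm _ _; set y := rsqnorm _ _ => xe ye.
have x0 : 0 <= y by exact: rsqnorm_ge0.
have : normsq c * y <= M * y by rewrite ler_wpM2r // lerDr.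
have : M * y < eps / 4.
  rewrite (_ : eps / 4 = M * (eps / (4 * M))) ?ltr_pM2l //.
  by field; rewrite gt_eqF.
by lra.
Qed.

Lemma fourier0 : fourier mu e (fun=> 0) (fun=> 0).
Proof.
have l0 : ell2 (fun _ : K => 0 : R[i]).
  apply: le_lt_trans (ltry 0); apply: ell2_le => F.
  by rewrite big1 // => k _; rewrite normsq0.
split=> //; first exact: in_L2_0.
move=> eps e0; exists fset0 => F _; rewrite /sqnorm.
under eq_integral => t _.
  rewrite /psum big1 => [|k _]; last by rewrite mulr0.
  rewrite subr0 normsq0; over.
by rewrite integral0 lte_fin.
Qed.

Lemma fourier_sum (I : Type) (s : seq I) (c : I -> R[i]) (a : I -> K -> R[i])
    (g : I -> T -> R[i]) : (forall i, fourier mu e (a i) (g i)) ->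
  fourier mu e (fun k => \sum_(i <- s) c i * a i k)
    (fun t => \sum_(i <- s) c i * g i t).
Proof.
move=> ag; elim: s => [|i s IH].
  under eq_fun do rewrite big_nil.
  under [X in fourier _ _ _ X]eq_fun do rewrite big_nil.
  exact: fourier0.
under eq_fun do rewrite big_cons.
under [X in fourier _ _ _ X]eq_fun do rewrite big_cons.
exact: fourier_lin (ag i) IH.
Qed.

End FourierIso.

(** * Fourier series on the torus *)

Section TorusBasis.
Variables (R : realType) (d : nat).
Local Notation pt := (d.-tuple (measurableTypeR R)).
Local Notation mu := (torus R d).
Implicit Types (n k : 'rV[int]_d) (th : pt) (g : pt -> R[i]).

Lemma expiD (s t : R) : expi (s + t) = expi s * expi t.
Proof. by rewrite /expi cosD sinD; simpc; congr Complex; ring. Qed.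

Lemma expi0 : expi 0 = 1 :> R[i].
Proof. by rewrite /expi cos0 sin0. Qed.

Lemma normsq_expi (s : R) : normsq (expi s) = 1.
Proof. exact: cos2Dsin2. Qed.

Lemma dotD (x y : 'rV[R]_d) th : dot (x + y) th = dot x th + dot y th.
Proof. by rewrite /dot -big_split; apply: eq_bigr => i _; rewrite mxE mulrDl. Qed.

Lemma dotN (x : 'rV[R]_d) th : dot (- x) th = - dot x th.
Proof. by rewrite /dot -sumrN; apply: eq_bigr => i _; rewrite mxE mulNr. Qed.

Lemma measurable_dot (x : 'rV[R]_d) : measurable_fun setT (dot x : pt -> R).
Proof.
apply: measurable_sum => i.
by apply: measurable_funM => //; exact: measurable_tnth.
Qed.

Lemma cmeasurable_expi_dot (x : 'rV[R]_d) :
  cmeasurable (fun th : pt => expi (dot x th)).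
Proof.
split; apply: measurableT_comp (measurable_dot x); apply: continuous_measurable_fun.
  exact: continuous_cos.
exact: continuous_sin.
Qed.

Lemma zvecD n k : zvec (n + k) = zvec n + zvec k :> 'rV[R]_d.
Proof. by apply/rowP => i; rewrite !mxE rmorphD. Qed.

Lemma zvecN n : zvec (- n) = - zvec n :> 'rV[R]_d.
Proof. by apply/rowP => i; rewrite !mxE rmorphN. Qed.

Lemma zvec0 : zvec 0 = 0 :> 'rV[R]_d.
Proof. by apply/rowP => i; rewrite !mxE. Qed.

Lemma dot_zvec n th : dot (zvec n) th = phase (fun i => n ord0 i) th.
Proof. by apply: eq_bigr => i _; rewrite mxE. Qed.

(** The sign is that of the Gelfand transformation. *)
Definition chi n th : R[i] := expi (- dot (zvec n) th).

Lemma cmeasurable_chi n : cmeasurable (chi n).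
Proof. by rewrite /chi; under eq_fun do rewrite -dotN; exact: cmeasurable_expi_dot. Qed.

Lemma chi_unimodular n th : normsq (chi n th) = 1.
Proof. exact: normsq_expi. Qed.

Lemma torus_cos (k : 'I_d -> int) (s : R) :
  \int[mu]_th cos (s + phase k th) = [forall i, k i == 0]%:R * cos s.
Proof.
have ic : mu.-integrable setT (fun th => (cos (s + phase k th))%:E).
  have i1 : mu.-integrable setT (EFin \o (fun=> (1 : R))).
    exact: finite_measure_integrable_cst.
  have := integrable_mul_bounded i1 (measurable_cos_phase k s) (M := 1).
  rewrite (_ : EFin \o _ = fun th => (cos (s + phase k th))%:E).
    by apply => th; rewrite ler_norml cos_geN1 cos_le1.
  by apply/funext => th /=; rewrite mul1r.
have := torus_1cos k s => E.
apply: (addrI 1); rewrite -[RHS]/(fine (1 + [forall i, k i == 0]%:R * cos s)%:E) -E.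
transitivity (\int[mu]_th (1 + cos (s + phase k th))) => //.
rewrite RintegralD //; last exact: finite_measure_integrable_cst.
by rewrite Rintegral_probability_cst.
Qed.

Lemma chi_orthonormal j k : coef mu chi (chi j) k = (j == k)%:R.
Proof.
have jkE : [forall i, (fun i => j ord0 i + - k ord0 i) i == 0] = (j == k).
  apply/forallP/eqP => [H|-> i]; last by rewrite subrr.
  by apply/rowP => i; apply/eqP; rewrite -subr_eq0; exact: H.
pose l i := j ord0 i + - k ord0 i.
have lE th : phase l th = dot (zvec j) th - dot (zvec k) th.
  by rewrite !dot_zvec /l phaseD phaseN.
rewrite /coef.
have -> : \int[mu]_th re_prod (chi j) (chi k) th = \int[mu]_th cos (0 + phase l th).
  apply: eq_Rintegral => th _; rewrite add0r lE cosB /re_prod /chi /expi /=.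
  by rewrite !cosN !sinN; ring.
have -> : \int[mu]_th im_prod (chi j) (chi k) th = \int[mu]_th cos (pi / 2 + phase l th).
  apply: eq_Rintegral => th _; rewrite addrC cosDpihalf lE sinB /im_prod /chi /expi /=.
  by rewrite !cosN !sinN; ring.
rewrite !torus_cos jkE cos0 cos_pihalf mulr0 mulr1.
by case: (j == k).
Qed.

(** A coefficient mixes the real and the imaginary part of [g].  Adding and
subtracting the coefficients at [k] and [- k] separates them, so that each part
is orthogonal to all cosines and sines. *)
Lemma chi_complete g : in_L2 mu g -> (forall k, coef mu chi g k = 0) ->
  {ae mu, forall th, g th = 0}.
Proof.
move=> Lg cg0; have [iu iv] := in_L2_integrable Lg.
pose u th := complex.Re (g th); pose v th := complex.Im (g th).
have mcos (k : 'rV[int]_d) : measurable_fun setT (fun th : pt => cos (dot (zvec k) th)).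
  exact: (cmeasurable_expi_dot (zvec k)).1.
have msin (k : 'rV[int]_d) : measurable_fun setT (fun th : pt => sin (dot (zvec k) th)).
  exact: (cmeasurable_expi_dot (zvec k)).2.
have bcos (k : 'rV[int]_d) (th : pt) : `|cos (dot (zvec k) th)| <= 1.
  by rewrite ler_norml cos_geN1 cos_le1.
have bsin (k : 'rV[int]_d) (th : pt) : `|sin (dot (zvec k) th)| <= 1.
  by rewrite ler_norml sin_geN1 sin_le1.
have iuc k := integrable_mul_bounded iu (mcos k) (bcos k).
have ius k := integrable_mul_bounded iu (msin k) (bsin k).
have ivc k := integrable_mul_bounded iv (mcos k) (bcos k).
have ivs k := integrable_mul_bounded iv (msin k) (bsin k).
pose UC k := \int[mu]_th (u th * cos (dot (zvec k) th)).
pose US k := \int[mu]_th (u th * sin (dot (zvec k) th)).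
pose VC k := \int[mu]_th (v th * cos (dot (zvec k) th)).
pose VS k := \int[mu]_th (v th * sin (dot (zvec k) th)).
have reE k : UC k - VS k = 0.
  have := congr1 (@complex.Re R) (cg0 k) => /= <-.
  rewrite -RintegralB //; apply: eq_Rintegral => th _.
  by rewrite /re_prod /chi /expi /= cosN sinN /u /v; ring.
have imE k : VC k + US k = 0.
  have := congr1 (@complex.Im R) (cg0 k) => /= <-.
  rewrite -RintegralD //; apply: eq_Rintegral => th _.
  by rewrite /im_prod /chi /expi /= cosN sinN /u /v; ring.
have UCN k : UC (- k) = UC k.
  by apply: eq_Rintegral => th _; rewrite zvecN dotN cosN.
have VCN k : VC (- k) = VC k.
  by apply: eq_Rintegral => th _; rewrite zvecN dotN cosN.
have USN k : US (- k) = - US k.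
  rewrite -mulN1r -RintegralZl //; apply: eq_Rintegral => th _.
  by rewrite zvecN dotN sinN; ring.
have VSN k : VS (- k) = - VS k.
  rewrite -mulN1r -RintegralZl //; apply: eq_Rintegral => th _.
  by rewrite zvecN dotN sinN; ring.
have zero k : [/\ UC k = 0, US k = 0, VC k = 0 & VS k = 0].
  have := reE k; have := imE k; have := reE (- k); have := imE (- k).
  by rewrite UCN VCN USN VSN; split; lra.
have ph (k : 'I_d -> int) s (th : pt) : cos (s + phase k th) =
    cos s * cos (dot (zvec (\row_i k i)) th) - sin s * sin (dot (zvec (\row_i k i)) th).
  rewrite cosD dot_zvec; congr (_ * cos _ - _ * sin _);
  by apply: eq_bigr => i _; rewrite mxE.
have u0 : {ae mu, forall th, u th = 0}.
  apply: torus_fourier_unique => // k s.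
  transitivity (cos s * UC (\row_i k i) - sin s * US (\row_i k i)).
    rewrite -!RintegralZl // -RintegralB //; last 2 first.
    - exact: (integrableZl measurableT _ (iuc _)).
    - exact: (integrableZl measurableT _ (ius _)).
    by apply: eq_Rintegral => th _; rewrite ph; ring.
  by have [-> -> _ _] := zero (\row_i k i); ring.
have v0 : {ae mu, forall th, v th = 0}.
  apply: torus_fourier_unique => // k s.
  transitivity (cos s * VC (\row_i k i) - sin s * VS (\row_i k i)).
    rewrite -!RintegralZl // -RintegralB //; last 2 first.
    - exact: (integrableZl measurableT _ (ivc _)).
    - exact: (integrableZl measurableT _ (ivs _)).
    by apply: eq_Rintegral => th _; rewrite ph; ring.
  by have [_ _ -> ->] := zero (\row_i k i); ring.
apply: filterS2 u0 v0 => th; rewrite /u /v.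
by case: (g th) => x y /= -> ->.
Qed.

Lemma sqnorm_unimodular (w g : pt -> R[i]) : (forall th, normsq (w th) = 1) ->
  sqnorm mu (fun th => w th * g th) = sqnorm mu g.
Proof. by move=> w1; apply: eq_integral => th _; rewrite normsqM w1 mul1r. Qed.

Lemma in_L2_unimodular (w g : pt -> R[i]) : cmeasurable w ->
  (forall th, normsq (w th) = 1) -> in_L2 mu g ->
  in_L2 mu (fun th => w th * g th).
Proof.
move=> mw w1 [mg fg]; split; first exact: cmeasurableM.
by rewrite sqnorm_unimodular.
Qed.

(** The partial sums of the shifted coefficients over [F] are those of [a] over
the translate of [F], up to a factor of modulus 1. *)
Lemma fourier_shift a g k : fourier mu chi a g ->
  fourier mu chi (fun n => a (n + k)) (fun th => expi (dot (zvec k) th) * g th).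
Proof.
move=> [la Lg fg].
have img (F : {fset 'rV[int]_d}) : \sum_(n <- F) normsq (a (n + k)) =
    \sum_(n <- [fset (n + k)%R | n in F]%fset) normsq (a n).
  rewrite big_imfset //= => x y _ _; exact: addIr.
split.
- apply: le_lt_trans la; apply: ell2_le => F; rewrite img; exact: ell2_ge.
- apply: in_L2_unimodular => // [|th]; first exact: cmeasurable_expi_dot.
  exact: normsq_expi.
move=> eps e0; have [F0 H0] := fg eps e0.
exists [fset (n - k)%R | n in F0]%fset => F F0F.
have F0F' : (F0 `<=` [fset (n + k)%R | n in F])%fset.
  apply/fsubsetP => n nF0; apply/imfsetP; exists (n - k); last by rewrite subrK.
  by apply: (fsubsetP F0F); apply/imfsetP; exists n.
have := H0 _ F0F'.
rewrite -(sqnorm_unimodular (w := fun th => expi (dot (zvec k) th))); last first.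
  by move=> th; exact: normsq_expi.
congr (_ < _)%E; congr sqnorm; apply/funext => th.
rewrite mulrBr; congr (_ - _); rewrite /psum big_imfset /=; last first.
  by move=> x y _ _; exact: addIr.
rewrite mulr_sumr; apply: eq_bigr => n _.
rewrite mulrA /chi zvecD dotD opprD -expiD; congr (expi _ * _); ring.
Qed.

End TorusBasis.

(** * Walks, potentials and integral forms *)

Section Walks.
Variables (V E : Type) (G : mgraph V E).

Lemma tgt_inv e : tgt G (Defs.inv G e) = src G e.
Proof. by rewrite -src_inv Defs.invK. Qed.

Lemma walk_cat u p w q v : walk G u p w -> walk G w q v -> walk G u (p ++ q) v.
Proof.
by elim: p u => [|e p IH] u /= => [->//|[-> wp] wq]; split=> //; exact: IH.
Qed.

Definition rev_walk (p : seq E) := rev (map (Defs.inv G) p).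

Lemma walk_rev u p v : walk G u p v -> walk G v (rev_walk p) u.
Proof.
elim: p u => [|e p IH] u /=; first by move->.
case=> <- /IH wp; rewrite /rev_walk map_cons rev_cons -cats1; apply: walk_cat wp _.
by rewrite /= src_inv tgt_inv.
Qed.

Lemma sum_rev_walk (W : zmodType) (b : E -> W) p :
  (forall e, b (Defs.inv G e) = - b e) ->
  \sum_(e <- rev_walk p) b e = - \sum_(e <- p) b e.
Proof.
move=> bi; rewrite /rev_walk; elim: p => [|e p IH]; first by rewrite !big_nil oppr0.
by rewrite map_cons rev_cons big_rcons /= IH big_cons bi opprD addrC.
Qed.

Lemma sum_gradient (W : zmodType) (f : V -> W) u p v : walk G u p v ->
  \sum_(e <- p) (f (src G e) - f (tgt G e)) = f u - f v.
Proof.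
elim: p u => [|e p IH] u /=; first by move->; rewrite big_nil subrr.
by case=> <- /IH wp; rewrite big_cons wp addrA subrK.
Qed.

End Walks.

Section Flux.
Variables (R : realType) (d : nat) (V A : finType) (G : mgraph V A).
Implicit Types b : A -> 'rV[R]_d.

Lemma fluxB b c1 c2 : flux b (c1 - c2) = flux b c1 - flux b c2.
Proof.
rewrite /flux -scalerBr -sumrB; congr (_ *: _); apply: eq_bigr => e _.
by rewrite !ffunE rmorphB scalerBl.
Qed.

Lemma flux_gradient b b' (f : V -> 'rV[R]_d) : one_form G b ->
  (forall e, b' e = b e + (f (src G e) - f (tgt G e))) ->
  forall c, cycle_space G c -> flux b c = flux b' c.
Proof.
move=> bf b'E c; elim=> [u p wp|c1 c2 _ IH1 _ IH2]; last by rewrite !fluxB IH1 IH2.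
have b'f : one_form G b'.
  by move=> e; rewrite !b'E bf src_inv tgt_inv opprD opprB.
rewrite !flux_path //; under [RHS]eq_bigr do rewrite b'E.
by rewrite big_split /= (sum_gradient _ wp) subrr addr0.
Qed.

(** On a connected graph a cycle can be conjugated to start at [r], and there the
difference of two cycles is realized by following the second one backwards; so
passing from walks to the group which they generate yields no new fluxes. *)
Lemma flux_closed_walk b r c : connected_graph G -> one_form G b ->
  cycle_space G c -> exists2 p, walk G r p r & flux b c = \sum_(e <- p) b e.
Proof.
move=> conn bf; elim=> [u p wp|c1 c2 _ [p1 w1 E1] _ [p2 w2 E2]].
  have [q wq] := conn r u.
  exists (q ++ (p ++ rev_walk G q)).
    exact: walk_cat wq (walk_cat wp (walk_rev wq)).
  by rewrite flux_path // !big_cat /= sum_rev_walk // addrCA subrr addr0.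
exists (p1 ++ rev_walk G p2); first exact: walk_cat w1 (walk_rev w2).
by rewrite fluxB E1 E2 big_cat /= sum_rev_walk.
Qed.

Lemma zvec_inj : injective (@zvec R d).
Proof.
move=> x y /rowP H; apply/rowP => i; have := H i; rewrite !mxE.
exact: intr_inj.
Qed.

Lemma zvec_sum (I : Type) (s : seq I) (f : I -> 'rV[int]_d) :
  zvec (\sum_(i <- s) f i) = \sum_(i <- s) zvec (f i) :> 'rV[R]_d.
Proof.
elim: s => [|i s IH]; first by rewrite !big_nil zvec0.
by rewrite !big_cons zvecD IH.
Qed.

(** The value [t e] is the flux of the closed walk which goes from [r] to the
source of [e], crosses [e] and comes back. *)
Lemma integer_form b (r : V) : connected_graph G -> one_form G b ->
  [set flux b c | c in cycle_space G] = range (@zvec R d) ->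
  exists (phi : V -> 'rV[R]_d) (t : A -> 'rV[int]_d),
    forall e, zvec (t e) = b e + (phi (src G e) - phi (tgt G e)).
Proof.
move=> conn bf bZ.
have /choice[pth pthP] : forall v, exists p, walk G r p v by move=> v; exact: conn.
pose phi v := \sum_(e <- pth v) b e; exists phi.
suff /choice[t tP] : forall e, exists z : 'rV[int]_d,
    zvec z = b e + (phi (src G e) - phi (tgt G e)) by exists t.
move=> e.
have wc : walk G r (pth (src G e) ++ (e :: rev_walk G (pth (tgt G e)))) r.
  by apply: walk_cat (pthP _) _ => /=; split=> //; exact: walk_rev (pthP _).
have : [set flux b c | c in cycle_space G] (flux b (path_chain G
    (pth (src G e) ++ (e :: rev_walk G (pth (tgt G e)))))).
  by eexists; first exact: cycle_space_cycle wc.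
rewrite bZ flux_path // => -[z _ zE]; exists z; rewrite zE.
by rewrite big_cat big_cons /= sum_rev_walk // addrCA.
Qed.

End Flux.

(** * The periodic graph of an integral form *)

Section Cover.
Variables (R : realType) (d : nat) (V A : finType) (G : mgraph V A).
Variables (r : V) (t : A -> 'rV[int]_d).
Hypothesis d_gt0 : (0 < d)%N.
Hypothesis conn : connected_graph G.
Hypothesis t_inv : forall e, t (Defs.inv G e) = - t e.
Hypothesis t_full : forall z, exists2 p, walk G r p r & \sum_(e <- p) t e = z.

Local Notation pV := (V * 'rV[int]_d)%type.
Local Notation pE := (A * 'rV[int]_d)%type.

Definition cover_src (e : pE) : pV := (src G e.1, e.2).
Definition cover_tgt (e : pE) : pV := (tgt G e.1, e.2 + t e.1).
Definition cover_inv (e : pE) : pE := (Defs.inv G e.1, e.2 + t e.1).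

Lemma cover_invK : involutive cover_inv.
Proof. by case=> e n; rewrite /cover_inv /= Defs.invK t_inv addrK. Qed.

Lemma cover_inv_neq e : cover_inv e <> e.
Proof. by case: e => e n [eE _]; exact: (inv_neq eE). Qed.

Lemma cover_src_inv e : cover_src (cover_inv e) = cover_tgt e.
Proof. by case: e => e n; rewrite /cover_src /cover_tgt /= src_inv. Qed.

Definition cover_graph : mgraph pV pE :=
  MGraph cover_invK cover_inv_neq cover_src_inv.

(** Distinct vertices of [G] need distinct positions in the fundamental cell; the
points used lie on its diagonal. *)
Definition offset (v : V) : R := (enum_rank v)%:R / #|V|%:R.

Lemma offset_itv v : 0 <= offset v < 1.
Proof.
have V0 : (0 < #|V|)%N by apply/card_gt0P; exists v.
rewrite divr_ge0 ?ler0n //= ltr_pdivrMr ?ltr0n // mul1r ltr_nat.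
exact: ltn_ord.
Qed.

Lemma offset_inj : injective offset.
Proof.
move=> u v; have V0 : #|V|%:R != 0 :> R.
  by rewrite pnatr_eq0 -lt0n; apply/card_gt0P; exists u.
by move/(mulIf (invr_neq0 V0))/eqP; rewrite eqr_nat => /eqP/val_inj/enum_rank_inj.
Qed.

Definition cover_pos (v : pV) : 'rV[R]_d := zvec v.2 + const_mx (offset v.1).

Lemma floor_cover_pos v : map_mx Num.floor (cover_pos v) = v.2.
Proof.
apply/rowP => i; rewrite !mxE; apply: floor_def.
have /andP[x0 x1] := offset_itv v.1.
by rewrite lerDl x0 rmorphD ltrD2l.
Qed.

Lemma cover_pos_inj : injective cover_pos.
Proof.
move=> [u n] [v k] E; have := congr1 (map_mx Num.floor) E.
rewrite !floor_cover_pos /= => nk; rewrite nk in E *; congr (_, _).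
have /rowP/(_ (Ordinal d_gt0)) := E.
by rewrite !mxE /= => /addrI /offset_inj.
Qed.

Definition cover_trV k (v : pV) : pV := (v.1, k + v.2).
Definition cover_trE k (e : pE) : pE := (e.1, k + e.2).

Lemma cover_pos_trV k v : cover_pos (cover_trV k v) = cover_pos v + zvec k *m 1%:M.
Proof. by rewrite /cover_pos /= zvecD mulmx1 addrC addrA (addrC (zvec v.2)) addrAC. Qed.

Lemma cover_trE0 e : cover_trE 0 e = e.
Proof. by case: e => e n; rewrite /cover_trE /= add0r. Qed.

Lemma cover_trED n n' e : cover_trE (n + n') e = cover_trE n (cover_trE n' e).
Proof. by rewrite /cover_trE /= addrA. Qed.

Lemma cover_src_trE n e : cover_src (cover_trE n e) = cover_trV n (cover_src e).
Proof. by []. Qed.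

Lemma cover_inv_trE n e : cover_inv (cover_trE n e) = cover_trE n (cover_inv e).
Proof. by rewrite /cover_inv /cover_trE /= addrA. Qed.

Lemma walk_lift u p v n : walk G u p v ->
  exists q, walk cover_graph (u, n) q (v, n + \sum_(e <- p) t e).
Proof.
elim: p u n => [|e p IH] u n /=.
  by move=> ->; exists [::]; rewrite big_nil addr0.
case=> <- /(IH _ (n + t e)) [q wq]; exists ((e, n) :: q).
by rewrite big_cons addrA.
Qed.

(** A walk of [G] from [u] to [v] through the root lifts to a walk ending over
[v], at a level that a closed walk inserted at the root can correct to any
prescribed one. *)
Lemma cover_connected : connected_graph cover_graph.
Proof.
move=> [u n] [v k]; have [p wp] := conn u r; have [q wq] := conn r v.
have [c wc cE] := t_full (k - n - \sum_(e <- p) t e - \sum_(e <- q) t e).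
have := walk_lift n (walk_cat wp (walk_cat wc wq)).
by rewrite !big_cat /= cE subrK (addrC (\sum_(e <- p) t e)) subrK addrC subrK.
Qed.

Lemma cover_infinite : infinite_set [set: pV].
Proof.
move=> /(finite_image (fun v : pV => `|v.2 ord0 (Ordinal d_gt0)|%N)).
apply: contra_not infinite_nat; apply: sub_finite_set => n _.
by exists (r, const_mx n%:Z) => //=; rewrite mxE.
Qed.

Lemma cover_locally_finite v : finite_set [set e | cover_src e = v].
Proof.
apply: (@sub_finite_set _ _ ((fun a => (a, v.2)) @` [set: A])).
  by move=> [a n] <-; exists a.
by apply: finite_image; exact: finite_finset.
Qed.

Lemma cover_finite_vertices : exists2 F : set pV, finite_set F &
  forall v, exists n u, F u /\ v = cover_trV n u.
Proof.
exists ((fun v => (v, 0)) @` [set: V]).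
  by apply: finite_image; exact: finite_finset.
move=> [v n]; exists n, (v, 0); split; first by exists v.
by rewrite /cover_trV /= addr0.
Qed.

Lemma cover_finite_edges : exists2 F : set pE, finite_set F &
  forall e, exists n u, F u /\ e = cover_trE n u.
Proof.
exists ((fun v => (v, 0)) @` [set: A]).
  by apply: finite_image; exact: finite_finset.
move=> [v n]; exists n, (v, 0); split; first by exists v.
by rewrite /cover_trE /= addr0.
Qed.

Definition lattice_cover : periodic_graph R d :=
  @PeriodicGraph R d pV pE cover_graph 1%:M (unitmx1 R d) cover_pos cover_pos_inj
    cover_trV cover_trE cover_pos_trV cover_trE0 cover_trED cover_src_trE
    cover_inv_trE cover_connected cover_infinite cover_locally_finite
    cover_finite_vertices cover_finite_edges.

Lemma cover_projV_orbit (u v : pV) : u.1 = v.1 <-> exists n, v = cover_trV n u.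
Proof.
case: u v => [u n] [v k] /=; split=> [->|[z []//]].
by exists (k - n); rewrite /cover_trV /= subrK.
Qed.

Lemma cover_projE_orbit (e f : pE) : e.1 = f.1 <-> exists n, f = cover_trE n e.
Proof.
case: e f => [u n] [v k] /=; split=> [->|[z []//]].
by exists (k - n); rewrite /cover_trE /= subrK.
Qed.

Definition cover_cellV (v : V) : pV := (v, 0).

Lemma cover_coords x : coords lattice_cover x = x.
Proof. by rewrite /coords /= invmx1 mulmx1. Qed.

Lemma cover_cellV_cell v :
  fundamental_cell lattice_cover (pos (cover_cellV v : pvertex lattice_cover)).
Proof.
move=> s; rewrite cover_coords /= /cover_pos zvec0 add0r mxE.
exact: offset_itv.
Qed.

Lemma cover_projE_surj a : exists e : pE, e.1 = a.
Proof. by exists (a, 0). Qed.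

Definition lattice_cover_fundamental : fundamental_graph lattice_cover G :=
  @FundamentalGraph R d lattice_cover V A G fst fst cover_cellV cover_projV_orbit
    cover_projE_orbit cover_projE_surj (fun=> erefl) (fun=> erefl) (fun=> erefl)
    cover_cellV_cell.

Lemma cover_int_part (v : pvertex lattice_cover) : int_part v = v.2.
Proof. by rewrite /int_part cover_coords; exact: floor_cover_pos. Qed.

Definition cover_kappa (e : A) : 'rV[R]_d :=
  zvec (t e) + (const_mx (offset (tgt G e)) - const_mx (offset (src G e))).

Lemma cover_coordinate_form : coordinate_form lattice_cover_fundamental cover_kappa.
Proof.
move=> [e n]; rewrite !cover_coords; apply/rowP => i.
by rewrite /= /cover_pos /cover_kappa /= !mxE rmorphD /=; ring.
Qed.

Lemma cover_index_form : index_form lattice_cover_fundamental (fun e => zvec (t e)).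
Proof.
by move=> [e n]; rewrite !cover_int_part /= zvecD addrC addKr.
Qed.

Lemma cover_laplacian (f : pvertex lattice_cover -> R[i]) v n :
  laplacian f (v, n) = #|[set e | src G e == v]%SET|%:R * f (v, n) -
    \sum_(e | src G e == v) f (tgt G e, n + t e).
Proof.
rewrite /laplacian.
have -> : [set e : pedge lattice_cover | src lattice_cover e = (v, n)] =
    (fun a => (a, n)) @` [set a | src G a = v].
  apply/seteqP; split=> [[a k] [av kn]|_ [a av <-]] /=; last by congr (_, _).
  by exists a => //; rewrite -kn.
rewrite fsbig_image /=; last by move=> x y _ _ [].
have -> : [set a | src G a = v] = [set` [pred a | src G a == v]].
  by apply/seteqP; split=> a /= /eqP.
rewrite -(@bigfs _ _ _ _ (index_enum A)) ?index_enum_uniq //; last first.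
  by move=> a _; rewrite mem_index_enum.
rewrite sumrB sumr_const mulr_natl; congr (_ *+ _ - _).
by apply: eq_card => a; rewrite !inE.
Qed.

End Cover.

(** * The Laplacian in the Gelfand representation *)

Lemma ell2_sqnorm_pair (R : realType) (V : finType) (K : choiceType) (f : V * K -> R[i]) :
  ell2_sqnorm f = (\sum_(v : V) ell2_sqnorm (fun k => f (v, k)))%E.
Proof.
have nn (x : V * K) : (0 <= (normsq (f x))%:E)%E by rewrite lee_fin normsq_ge0.
transitivity (\esum_(v in [set: V]) ell2_sqnorm (fun k => f (v, k)))%E.
  rewrite /ell2_sqnorm esum_esum /=; last by move=> *; exact: nn.
  rewrite (_ : [set: V] `*`` _ = [set: V * K]); last by apply/seteqP; split.
  by apply: eq_esum => -[v k].
rewrite esum_fset; [|exact: finite_finset|by move=> v _; exact: ell2_sqnorm_ge0].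
rewrite (_ : [set: V] = [set` xpredT]); last by apply/seteqP; split.
rewrite -(@bigfs _ _ _ _ (index_enum V)) ?index_enum_uniq //.
by move=> v _; rewrite mem_index_enum.
Qed.

Section SumEreal.
Variables (R : realType) (V : finType).

Lemma sume_lty (x : V -> \bar R) : (forall v, 0 <= x v)%E ->
  (\sum_v x v < +oo)%E <-> (forall v, x v < +oo)%E.
Proof.
move=> x0; split=> [H v|H]; last by apply: lte_sum_pinfty.
apply: le_lt_trans H; rewrite (bigD1 v) //= leeDl //.
by apply: sume_ge0.
Qed.

Lemma le_sume (x : V -> \bar R) v : (forall v, 0 <= x v)%E ->
  (x v <= \sum_v x v)%E.
Proof. by move=> x0; rewrite (bigD1 v) //= leeDl //; exact: sume_ge0. Qed.

End SumEreal.

Section FiberCover.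
Variables (R : realType) (d : nat) (V A : finType) (G : mgraph V A).
Variables (r : V) (t : A -> 'rV[int]_d).
Hypothesis d_gt0 : (0 < d)%N.
Hypothesis conn : connected_graph G.
Hypothesis t_inv : forall e, t (Defs.inv G e) = - t e.
Hypothesis t_full : forall z, exists2 p, walk G r p r & \sum_(e <- p) t e = z.

Local Notation P := (lattice_cover R d_gt0 conn t_inv t_full).
Local Notation Q := (lattice_cover_fundamental R d_gt0 conn t_inv t_full).
Local Notation pt := (d.-tuple (measurableTypeR R)).
Local Notation mu := (torus R d).
Local Notation chi := (@chi R d).
Local Notation chim := (@cmeasurable_chi R d).
Local Notation chi1 := (@chi_unimodular R d).
Local Notation chio := (@chi_orthonormal R d).
Local Notation chic := (@chi_complete R d).
Implicit Types (f : pvertex P -> R[i]) (g h : pt -> V -> R[i]).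

Lemma in_H_vertexwise g : in_H g <-> forall v, in_L2 mu (fun th => g th v).
Proof.
split=> [[mg fg] v|Lg].
  split; first exact: mg.
  by move/sume_lty : fg; apply=> u; exact: sqnorm_ge0.
split=> [v|]; first by case: (Lg v).
by apply/sume_lty => v; [exact: sqnorm_ge0|case: (Lg v)].
Qed.

Lemma ell2_vertexwise f : ell2 f <-> forall v, ell2 (fun n => f (v, n)).
Proof.
rewrite /ell2 ell2_sqnorm_pair; apply: sume_lty => v; exact: ell2_sqnorm_ge0.
Qed.

(** The norm of the direct integral is a finite sum over the vertices, so the
convergence may be tested at each vertex separately. *)
Lemma gelfand_vertexwise f g : gelfand Q f g <->
  forall v, fourier mu chi (fun n => f (v, n)) (fun th => g th v).
Proof.
have sumE F th v : gelfand_sum Q f F th v = psum chi (fun n => f (v, n)) F th.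
  by apply: eq_bigr => n _; congr (_ * f (v, _)); exact: addr0.
have HE F : H_sqnorm (fun th v => g th v - gelfand_sum Q f F th v) =
    (\sum_v sqnorm mu (fun th => (g th v - psum chi (fun n => f (v, n)) F th)%R))%E.
  apply: eq_bigr => v _; apply: eq_integral => th _.
  by rewrite sumE.
split=> [[lf Hg fg] v|fg].
  split; [exact: (ell2_vertexwise f).1|exact: (in_H_vertexwise g).1|].
  move=> eps /fg[F0 HF0]; exists F0 => F /HF0; rewrite HE; apply: le_lt_trans.
  by apply: (@le_sume _ _ (fun v => sqnorm mu _)) => u; exact: sqnorm_ge0.
split; first by apply/ell2_vertexwise => v; case: (fg v).
  by apply/in_H_vertexwise => v; case: (fg v).
(* Adding 1 avoids a division by zero and makes the final bound strict. *)
move=> eps e0; pose N : R := #|V|%:R + 1.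
have N0 : 0 < N by rewrite ltr_wpDl.
have /choice[F0 HF0] : forall v, exists F0 : {fset 'rV[int]_d},
    forall F : {fset 'rV[int]_d}, (F0 `<=` F)%fset ->
    (sqnorm mu (fun th => (g th v - psum chi (fun n => f (v, n)) F th)%R)
      < (eps / N)%:E)%E.
  by move=> v; have [_ _] := fg v; apply; rewrite divr_gt0.
exists (\bigcup_(v <- index_enum V) F0 v)%fset => F F0F; rewrite HE.
apply: (@le_lt_trans _ _ (\sum_(v : V) (eps / N)%:E)%E).
  apply: lee_sum => v _; apply/ltW/HF0; apply: fsubset_trans F0F.
  by apply: bigfcup_sup => //; rewrite mem_index_enum.
rewrite sumEFin lte_fin sumr_const -mulr_natl mulrCA gtr_pMr // ltr_pdivrMr //.
by rewrite mul1r ltrDl.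
Qed.


Variables (m : A -> 'rV[R]_d) (phi : V -> 'rV[R]_d).
Hypothesis m_form : one_form G m.
Hypothesis tE : forall e, zvec (t e) = m e + (phi (src G e) - phi (tgt G e)).
Variable v0 : V.

Let w v := phi v0 - phi v.

Lemma gauge_potential_cover :
  gauge_potential G v0 (fun e => zvec (t e) - m e) w.
Proof.
move=> p v wp; rewrite /w -(sum_gradient phi wp); apply: eq_bigr => e _.
by rewrite tE addrAC subrr add0r.
Qed.

Lemma same_flux_cover : same_flux G (cover_kappa R G t) m.
Proof.
split=> // c cc; apply: (flux_gradient (f := fun v => phi v - const_mx (offset R v))) => // e.
by rewrite /cover_kappa tE; apply/rowP => i; rewrite !mxE; ring.
Qed.

Lemma in_H_gauge (x : V -> 'rV[R]_d) g : in_H g -> in_H (gauge x g).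
Proof.
move=> /in_H_vertexwise Lg; apply/in_H_vertexwise => v.
by apply: in_L2_unimodular => // [|th]; [exact: cmeasurable_expi_dot|exact: normsq_expi].
Qed.

Lemma H_sqnorm_gauge (x : V -> 'rV[R]_d) g : H_sqnorm (gauge x g) = H_sqnorm g.
Proof.
apply: eq_bigr => v _; apply: sqnorm_unimodular => th; exact: normsq_expi.
Qed.

Lemma gaugeK (x : V -> 'rV[R]_d) g : gauge x (gauge (fun v => - x v) g) = g.
Proof.
apply/funext => th; apply/funext => v.
by rewrite /gauge mulrA -expiD dotN subrr expi0 mul1r.
Qed.

Lemma gelfand_surj g : in_H g -> exists f, gelfand Q f g.
Proof.
move=> /in_H_vertexwise Lg.
exists (fun x => coef mu chi (fun th => g th x.1) x.2).
apply/gelfand_vertexwise => v.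
exact: (fourier_surj chim chi1 chio chic (Lg v)).
Qed.

Lemma gelfand_exists f : ell2 f -> exists g, gelfand Q f g.
Proof.
move=> /ell2_vertexwise lf.
have /choice[g gP] : forall v, exists g : pt -> R[i],
    fourier mu chi (fun n => f (v, n)) g.
  move=> v.
  exact: (fourier_exists chim chi1 chio (lf v)).
by exists (fun th v => g v th); apply/gelfand_vertexwise.
Qed.

Lemma gelfand_isometry f g : gelfand Q f g -> H_sqnorm g = ell2_sqnorm f.
Proof.
move=> /gelfand_vertexwise fg; rewrite ell2_sqnorm_pair.
apply: eq_bigr => v _.
exact: (parseval chim chi1 chio (fg v)).
Qed.

Lemma gelfand_lin (a : R[i]) f g f' g' : gelfand Q f g -> gelfand Q f' g' ->
  gelfand Q (fun x => a * f x + f' x) (fun th v => a * g th v + g' th v).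
Proof.
move=> /gelfand_vertexwise fg /gelfand_vertexwise fg'; apply/gelfand_vertexwise => v.
exact: (fourier_lin chim chi1 a (fg v) (fg' v)).
Qed.

Lemma gelfand_eq_H f g h : gelfand Q f g -> in_H h -> eq_H h g -> gelfand Q f h.
Proof.
move=> /gelfand_vertexwise fg /in_H_vertexwise Lh hg; apply/gelfand_vertexwise => v.
apply: (fourier_ae chim chi1 (fg v)); first by case: (Lh v).
by apply: filterS hg => th; apply.
Qed.

Lemma gelfand_unique f g h : gelfand Q f g -> gelfand Q f h -> eq_H g h.
Proof.
move=> /gelfand_vertexwise fg /gelfand_vertexwise fh.
apply: filter_forall => v.
exact: (fourier_unique chim chi1 chio chic (fg v) (fh v)).
Qed.

(** The Laplacian of the cover is a combination of translations along the levels,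
one for each edge at [v], and each translation becomes a multiplication. *)
Lemma gelfand_laplacian f g : gelfand Q f g ->
  gelfand Q (laplacian f) (fun th => form_operator G (fun e => zvec (t e)) th (g th)).
Proof.
move=> /gelfand_vertexwise fg; apply/gelfand_vertexwise => v.
under eq_fun do rewrite cover_laplacian.
rewrite /form_operator.
have fs := fourier_sum chim chi1
  [seq e <- index_enum A | src G e == v] (fun=> -1)
  (fun e => fourier_shift (t e) (fg (tgt G e))).
have := fourier_lin chim chi1
  #|[set e | src G e == v]%SET|%:R (fg v) fs.
congr (fourier _ _ _ _).
  by apply/funext => n; congr (_ + _); rewrite /= -mulr_sumr mulN1r big_filter.
by apply/funext => th; congr (_ + _); rewrite /= -mulr_sumr mulN1r big_filter.
Qed.

(** Along an edge [e] the gauge contributes the gradient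
[phi (tgt e) - phi (src e)], which is exactly [m e - t e]. *)
Lemma form_operator_gauge g th :
  form_operator G m th (gauge w g th) =
  fun v => expi (dot (w v) th) * form_operator G (fun e => zvec (t e)) th (g th) v.
Proof.
apply/funext => v; rewrite /form_operator /gauge mulrBr; congr (_ - _).
  by rewrite mulrCA.
rewrite mulr_sumr; apply: eq_bigr => e /eqP ev; rewrite !mulrA -!expiD -!dotD.
congr (expi (dot _ _) * _); rewrite tE /w ev.
by apply/rowP => i; rewrite !mxE; ring.
Qed.

Theorem fiber_operator_cover : fiber_operator Q v0 (form_operator G m).
Proof.
exists (cover_kappa R G t), (fun e => zvec (t e)), m, w; split.
- exact: cover_coordinate_form.
- exact: cover_index_form.
- exact: same_flux_cover.
- exact: gauge_potential_cover.
split.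
  split.
  - by move=> f /gelfand_exists[g fg]; exists (gauge w g), g.
  - move=> g Hg; have [f fg] := gelfand_surj (in_H_gauge (fun v => - w v) Hg).
    by exists f, (gauge (fun v => - w v) g); rewrite ?gaugeK.
  - move=> f _ [g fg ->]; have [lf Hg _] := fg.
    by split=> //; [exact: in_H_gauge|rewrite H_sqnorm_gauge; exact: gelfand_isometry fg].
  - move=> a f _ f' _ [g fg ->] [g' fg' ->].
    exists (fun th v => a * g th v + g' th v); first exact: gelfand_lin.
    by apply/funext => th; apply/funext => v; rewrite /gauge; ring.
move=> g' h' Hg Hh; split.
  case=> f [g fg ->] [h fh ->].
  have := gelfand_unique fh (gelfand_laplacian fg).
  apply: filterS => th hth v; rewrite form_operator_gauge /gauge.
  by congr (_ * _); exact: hth.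
move=> hE.
have [f fg] := gelfand_surj (in_H_gauge (fun v => - w v) Hg).
exists f; first by eexists; [exact: fg|rewrite gaugeK].
exists (gauge (fun v => - w v) h'); last by rewrite gaugeK.
apply: gelfand_eq_H (gelfand_laplacian fg) _ _; first exact: in_H_gauge.
apply: filterS hE => th hth v; rewrite {1}/gauge hth -[in LHS](gaugeK w g').
by rewrite form_operator_gauge mulrA -expiD dotN addNr expi0 mul1r.
Qed.

End FiberCover.

Theorem corollary2p3 (R : realType) (d : nat) (V A : finType)
    (G : mgraph V A) (m : A -> 'rV[R]_d) :
  (0 < d)%N -> connected_graph G -> minimal_form G m ->
  [set flux m c | c in cycle_space G] = range (@zvec R d) ->
  exists (P : periodic_graph R d) (Q : fundamental_graph P G),
    forall v0 : V, fiber_operator Q v0 (form_operator G m).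
Proof.
move=> d_gt0 conn [m_form _] mZ.
have [r] : inhabited V.
  have : range (@zvec R d) 0 by exists 0 => //; exact: zvec0.
  rewrite -mZ => -[c cc _]; elim: cc => [u *|//].
  exact: inhabits u.
have [phi [t tE]] := integer_form r conn m_form mZ.
have t_inv e : t (Defs.inv G e) = - t e.
  apply: (@zvec_inj R d); rewrite zvecN !tE m_form src_inv tgt_inv.
  by rewrite opprD opprB.
have t_full z : exists2 p, walk G r p r & \sum_(e <- p) t e = z.
  have : range (@zvec R d) (zvec z) by exists z.
  rewrite -mZ => -[c cc cE]; have [p wp pE] := flux_closed_walk r conn m_form cc.
  exists p => //; apply: (@zvec_inj R d); rewrite zvec_sum -cE pE.
  rewrite (eq_bigr _ (fun e _ => tE e)) big_split /= (sum_gradient _ wp).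
  by rewrite subrr addr0.
exists (lattice_cover R d_gt0 conn t_inv t_full).
exists (lattice_cover_fundamental R d_gt0 conn t_inv t_full) => v0.
exact: fiber_operator_cover tE v0.
Qed.
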